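(* Let $G$ be a finite reduced group and let $r,t$ be two distinct primes. Then $r$ and $t$ are both cut vertices of $\Delta(G)$ if and only if, up to interchanging $r$ and $t$, there exist disjoint non-empty sets of primes $\alpha,\beta$ not containing $r$, with $\pi(G)=\{r\}\cup\alpha\cup\beta$, such that the following hold. (a) $t\in\beta$, and $G=ABR$, where $A$ is a Hall $\alpha$-subgroup, $B$ a Hall $\beta$-subgroup and $R$ a Sylow $r$-subgroup of $G$, all non-trivial, $AB$ is a subgroup of $G$ that is an $r$-complement of $G$, $A$, $B$ and $R$ are abelian, $\mathbf{F}(G)=A\times R$, $Z=\mathbf{Z}(AB)$ is a proper subgroup of $B$, $Z\neq 1$, $AB/Z$ is a Frobenius group with kernel $AZ/Z$, $\mathbf{C}_B(R)=1$, and $\mathbf{C}_B(x)\le Z$ for every non-trivial $x\in R$. (b) Denoting by $B^*$ the Hall $t'$-subgroup of $B$, we have $B^*\le Z$, and $B$ acts fixed-point freely (by conjugation) on $[R,B^*]$. Here $\alpha$ and $\beta$ are the vertex sets of the two (complete) connected components of $\Delta(G)-r$.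
   Context: All groups are finite. For a finite group $G$, $\Delta(G)$ is the simple undirected graph whose vertices are the primes dividing the size of some conjugacy class of $G$; two distinct vertices $p,q$ are adjacent if and only if $pq$ divides the size of some conjugacy class of $G$. For a vertex $r$ of a graph $\Delta$, $\Delta-r$ is the subgraph induced on the remaining vertices, and $r$ is a cut vertex of $\Delta$ if $\Delta-r$ has more connected components than $\Delta$. A finite group $G$ is reduced if it has no non-trivial normal (equivalently, central) subgroup $N$ with $G'\cap N=1$, where $G'$ is the derived subgroup. For a reduced group the vertex set of $\Delta(G)$ equals $\pi(G)$, the set of prime divisors of $|G|$. Notation: $\mathbf{F}(G)$ is the Fitting subgroup, $\mathbf{Z}(G)$ the center, $\mathbf{C}_H(\cdot)$ denotes centralizers in $H$; an $r$-complement is a Hall $r'$-subgroup. ''$B$ acts fixed-point freely on $X$'' means that no non-trivial element of $B$ centralizes a non-trivial element of $X$.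
   Formalization: In (b) the Hall t'-subgroup B* of B is additionally required to be non-trivial; with B* = 1 the ''if'' direction fails, e.g. for G = (C3 x C5):C4 with C4 faithful on C5 and inverting C3, r = 5, t = 2, where t is not a cut vertex. *)

(* Defs.v *)
From mathcomp Require Import all_boot all_fingroup all_solvable.

Set Implicit Arguments.
Unset Strict Implicit.
Unset Printing Implicit Defensive.

Import GroupScope.

(* A finite simple graph is given by a vertex set [S] in an ambient finite    *)
(* type together with a symmetric, irreflexive adjacency relation [e].        *)

Definition induced_rel (T : finType) (e : rel T) (S : {set T}) : rel T :=
  [rel x y | [&& x \in S, y \in S & e x y]].

Definition components (T : finType) (e : rel T) (S : {set T}) :
    {set {set T}} :=
  equivalence_partition (connect (induced_rel e S)) S.

Definition cut_vertex (T : finType) (e : rel T) (S : {set T}) (v : T) : Prop :=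
  v \in S /\ (#|components e S| < #|components e (S :\ v)|)%N.

Definition complete_on (T : finType) (e : rel T) (S : {set T}) : Prop :=
  {in S &, forall x y, x != y -> e x y}.

(* Primes dividing a class size of G are at most #|G|, so 'I_#|G|.+1 can      *)
(* serve as the ambient finite type for the vertices of Delta(G).             *)

Definition cs_vertices (gT : finGroupType) (G : {group gT}) :
    {set 'I_#|G|.+1} :=
  [set p : 'I_#|G|.+1 | prime p && [exists C in classes G, p %| #|C|]].

Definition cs_adj (gT : finGroupType) (G : {group gT}) : rel 'I_#|G|.+1 :=
  [rel p q : 'I_#|G|.+1 | [&& p \in cs_vertices G, q \in cs_vertices G, p != q
                            & [exists C in classes G, (p * q)%N %| #|C|]]].

Definition cs_cut_vertex (gT : finGroupType) (G : {group gT}) (r : nat) : Prop :=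
  exists2 v : 'I_#|G|.+1, val v = r & cut_vertex (@cs_adj _ G) (cs_vertices G) v.

(* The connected components of Delta(G) - r, as sets of primes. *)
Definition cs_components_minus (gT : finGroupType) (G : {group gT}) (r : nat) :
    {set {set 'I_#|G|.+1}} :=
  components (@cs_adj _ G) [set p in cs_vertices G | val p != r].

Definition primes_in (gT : finGroupType) (G : {group gT}) (pi : nat_pred) :
    {set 'I_#|G|.+1} :=
  [set p : 'I_#|G|.+1 | val p \in pi].

Definition reduced_group (gT : finGroupType) (G : {group gT}) : Prop :=
  forall N : {group gT}, N <| G -> G^`(1) :&: N = 1 -> N :=: 1.

Definition prime_partition (gT : finGroupType) (G : {group gT}) (r : nat)
    (alpha beta : nat_pred) : Prop :=
  [/\ exists p, p \in alpha, exists q, q \in beta,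
      forall p, ~~ ((p \in alpha) && (p \in beta)),
      (r \notin alpha) && (r \notin beta)
    & forall p, (p \in \pi(G)) = [|| p == r, p \in alpha | p \in beta]].

(* The group H is the product set AB. *)
Definition condition_a (gT : finGroupType) (G : {group gT}) (r t : nat)
    (alpha beta : nat_pred) (A B R H : {group gT}) : Prop :=
  [/\ t \in beta,
      [/\ A * B * R = G, alpha.-Hall(G) A, beta.-Hall(G) B & r.-Sylow(G) R],
      [/\ A :!=: 1, B :!=: 1 & R :!=: 1],
      A * B = H /\ r^'.-Hall(G) H
    & [/\ [/\ abelian A, abelian B & abelian R],
          A \x R = 'F(G),
          'Z(H) \proper B /\ 'Z(H) != 1,
          [Frobenius H / 'Z(H) with kernel (A * 'Z(H)) / 'Z(H)]
        & 'C_B(R) = 1 /\ {in R^#, forall x, 'C_B[x] \subset 'Z(H)}]].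

(* [Bs] is the Hall t'-subgroup of B. It has to be non-trivial: if R, A have *)
(* orders 5, 3, and B is cyclic of order 4, acting faithfully on R and by     *)
(* inversion on A, then G = (A x R)B is reduced and satisfies every other     *)
(* requirement for r = 5 and t = 2, but its class sizes are 1, 2, 4, 5, 10    *)
(* and 15, so Delta(G) is the path 3 - 5 - 2 and 2 is not a cut vertex.       *)
Definition condition_b (gT : finGroupType) (t : nat)
    (B R H Bs : {group gT}) : Prop :=
  [/\ t^'.-Hall(B) Bs, Bs :!=: 1, Bs \subset 'Z(H)
    & semiregular [~: R, Bs] B].

Definition two_cut_vertex_structure (gT : finGroupType) (G : {group gT})
    (r t : nat) (alpha beta : nat_pred) : Prop :=
  prime_partition G r alpha beta /\
  exists A B R H Bs : {group gT},
    condition_a G r t alpha beta A B R H /\ condition_b t B R H Bs.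

(* Main.v *)
Require Import Defs.
From mathcomp Require Import all_boot all_fingroup all_solvable.
From mathcomp Require Import ssralg finalg.

Set Implicit Arguments.
Unset Strict Implicit.
Unset Printing Implicit Defensive.

Import GroupScope.

(** Write n(x) for the size of the class of x.  Suppose that no edge joins p
    and q.  Every element of G then commutes with a conjugate of a Sylow
    p-subgroup P or with a conjugate of a Sylow q-subgroup Q, so the conjugates
    of 'C_G(P) and of 'C_G(Q) cover G.  Counting nontrivial elements, this is
    impossible if both centralisers have index at least 2 in the corresponding
    normalisers ([Sylow_cent_or]).  So one of the two primes, say p, satisfies
    the hypothesis 'N_G(P) \subset 'C(P) of Burnside's transfer theorem, and
    then G' is a p'-group ([der1_p'group]).  If this happens for all the primes
    of a set pi, then G has an abelian Hall pi-subgroup with a normal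
    complement, and a class size is prime to pi exactly when a conjugate of that
    Hall subgroup centralises the element.  This machinery replaces any appeal
    to solvability.

    Let r and t be cut vertices.  Removing r leaves a component alpha that is
    adjacent to r and avoids t; removing t leaves a component delta that is
    adjacent to t and avoids r; alpha and delta are disjoint and no edge joins
    them.

    If all the primes of alpha and of delta satisfy Burnside's hypothesis, then
    G = K ><| (A x E) with A, E abelian Hall subgroups for alpha and delta, and
    each element of K commutes with a conjugate of A or of E.  Class sizes of
    products x * y, with y in A and x in 'C_K[y], show that the index of 'C_K[y]
    in K is a power of t, and therefore that [~: K, <[y]>] lies in the Fitting
    subgroup L of K; the same holds for E.  As conjugating by K does not alter
    the action on L / L', that group is the union of the centralisers of an
    element of A and of an element of E, so it is one of them; by coprime action
    this element centralises K, which is absurd in a reduced group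
    ([no_two_separated_Hall]).

    Otherwise some prime of alpha, say, fails Burnside's hypothesis, and so every
    prime of beta = pi(G) - alpha - r satisfies it.  Then G = K ><| B with B an
    abelian Hall beta-subgroup, K an (alpha, r)-group.  An element of K that
    commutes with no conjugate of the Hall delta-subgroup E of B has a class size
    that is a (t, delta)-number, hence it is central in K.  No finite group is
    covered by the conjugates of a proper subgroup, so K = 'C_K(E) * 'Z(K), and
    from this K is abelian ([separated_kernel_abelian]).  For abelian K all
    class sizes are explicit: n(u * y) = #|K : 'C_K[y]| * #|B : 'C_B[u]| for
    commuting u in K and y in B.  The whole structure is read off from this
    formula ([separated_structure]), and conversely the formula gives all the
    edges of the graph of a group with that structure
    ([structure_class_sizes]). *)

(** * Counting conjugates *)

Section Counting.
Variable gT : finGroupType.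
Implicit Types G H K P Q : {group gT}.

(** There are as many conjugates of H as cosets of its normaliser; equality fails
    when they overlap outside 1. *)
Lemma leq_card_class_support G H :
  #|(class_support H G)^#| <= #|G : 'N_G(H)| * #|H^#|.
Proof.
rewrite class_supportD1 (leq_trans (leq_card_cover _)) //.
rewrite (eq_bigr (fun=> #|H^#|)) => [|_ /imsetP[x _ ->]]; last exact: cardJg.
by rewrite sum_nat_const card_conjugates normD1.
Qed.

Lemma cardGD1 G : #|G^#|.+1 = #|G|.
Proof. by rewrite (cardsD1 1 G) group1. Qed.

Lemma class_support_proper G H :
  H \subset G -> G \subset class_support H G -> H :=: G.
Proof.
move=> sHG sGH; apply/eqP; rewrite eqEcard sHG /= leqNgt; apply/negP => ltHG.
have := leq_trans (subset_leq_card (setSD [set 1] sGH)) (leq_card_class_support G H).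
apply/negP; rewrite -ltnNge.
have gt1 : 1 < #|G : H| by rewrite indexg_gt1 proper_subn // properEcard sHG.
have ltD : #|G : H| * #|H^#| < #|G^#|.
  rewrite -ltnS cardGD1 -(Lagrange sHG) -cardGD1 mulSn mulnC -add2n.
  by rewrite leq_add2r.
apply: leq_ltn_trans ltD; rewrite leq_mul2r; apply/orP; right.
by apply/dvdn_leq/indexgS; rewrite ?indexg_gt0 // subsetI sHG normG.
Qed.

(** The successor on the left is what makes the cover argument below strict: it
    comes from the identity, which lies in every conjugate. *)
Lemma leq_class_support_cent G P : ~~ ('N_G(P) \subset 'C(P)) ->
  (#|(class_support 'C_G(P) G)^#|.+1).*2 <= #|G|.
Proof.
move=> nNC.
have sCN : 'C_G(P) \subset 'N_G(P) by rewrite setIS ?cent_sub.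
have sNN : 'N_G(P) \subset 'N_G('C_G(P)).
  by rewrite subsetI subsetIl normsI ?(subset_trans (subsetIr _ _) (cent_norm _))
             ?subIset ?normG // orbC norms_cent.
have leN : #|'C_G(P)|.*2 <= #|'N_G('C_G(P))|.
  rewrite -(Lagrange (subset_trans sCN sNN)) -muln2 leq_mul2l; apply/orP; right.
  rewrite indexg_gt1; apply: contra nNC => sNC.
  exact: subset_trans (subset_trans sNN sNC) (subsetIr _ _).
have le1 : #|(class_support 'C_G(P) G)^#| <= #|G : 'N_G('C_G(P))| * #|'C_G(P)^#|.
  exact: leq_card_class_support.
rewrite -ltnS -leq_double in le1; apply: (leq_trans le1).
rewrite -(Lagrange (subsetIl G 'N('C_G(P)))) [leqRHS]mulnC.
apply: leq_trans _ (leq_mul (leqnn _) leN).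
rewrite -doubleMr leq_double -cardGD1 mulnS -addn1 addnC leq_add2r.
exact: indexg_gt0.
Qed.

(** If both inclusions fail, each of the two unions has at most #|G| / 2 - 1
    nontrivial elements, so together they miss one. *)
Lemma class_support_cent_cover G P Q :
    G \subset class_support 'C_G(P) G :|: class_support 'C_G(Q) G ->
  ('N_G(P) \subset 'C(P)) || ('N_G(Q) \subset 'C(Q)).
Proof.
move=> cov; apply/norP => -[/leq_class_support_cent leP /leq_class_support_cent leQ].
have := leq_add leP leQ; rewrite addnn -doubleD leq_double addSn addnS.
rewrite -cardGD1 ltnS ltnNge => /negP[].
apply: leq_trans _ (leq_card_setU _ _); apply: subset_leq_card.
by rewrite -setDUl setSD.
Qed.

End Counting.

(** * Burnside's transfer theorem *)

Section ClassSize.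
Variable gT : finGroupType.
Implicit Types G H K P Q : {group gT}.

Lemma p'_class_sub_cent p G P x : prime p -> p.-Sylow(G) P -> x \in G ->
  ~~ (p %| #|x ^: G|) -> x \in class_support 'C_G(P) G.
Proof.
move=> p_pr sylP Gx p'x.
have [Q sylQ] := Sylow_exists p 'C_G[x].
have sylQG : p.-Sylow(G) Q.
  rewrite pHallE (subset_trans (pHall_sub sylQ)) ?subsetIl //=.
  rewrite (card_Hall sylQ) -(Lagrange (subsetIl G 'C[x])) index_cent1.
  rewrite partnM ?cardG_gt0 //; last by rewrite -index_cent1 indexg_gt0.
  by rewrite (@part_p'nat p #|x ^: G|) ?muln1 // p'natE.
have [y Gy defQ] := Sylow_trans sylP sylQG.
have Gy1 : y^-1 \in G by rewrite groupV.
rewrite -[x](conjgKV y) memJ_class_support // inE groupJ //=.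
have : x \in 'C(Q) by rewrite -sub_cent1 (subset_trans (pHall_sub sylQ)) ?subsetIr.
by rewrite defQ centJ mem_conjg.
Qed.

Lemma Sylow_cent_or p q G P Q : prime p -> prime q ->
    p.-Sylow(G) P -> q.-Sylow(G) Q ->
    {in G, forall x, ~~ (p %| #|x ^: G|) || ~~ (q %| #|x ^: G|)} ->
  ('N_G(P) \subset 'C(P)) || ('N_G(Q) \subset 'C(Q)).
Proof.
move=> p_pr q_pr sylP sylQ nadj; apply: class_support_cent_cover.
apply/subsetP=> x Gx; rewrite inE.
case/orP: (nadj x Gx) => [p'x | q'x]; apply/orP; [left | right].
  exact: p'_class_sub_cent p'x.
exact: p'_class_sub_cent q'x.
Qed.

(** P and its conjugate by g are both Sylow in the centraliser of x ^ g, hence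
    conjugate there, so g may be corrected to an element normalising P. *)
Lemma Burnside_fusion p G P x g : p.-Sylow(G) P -> 'N_G(P) \subset 'C(P) ->
  x \in P -> g \in G -> x ^ g \in P -> x ^ g = x.
Proof.
move=> sylP sNC Px Gg Pxg; have [sPG pP _] := and3P sylP.
have abP : abelian P by rewrite /abelian (subset_trans _ sNC) // subsetI sPG normG.
have sylC Q : p.-Sylow(G) Q -> abelian Q -> x ^ g \in Q -> p.-Sylow('C_G[x ^ g]) Q.
  move=> sylQ abQ Qxg; apply: pHall_subl (sylQ); last exact: subsetIl.
  by rewrite subsetI (pHall_sub sylQ) sub_cent1 (subsetP abQ).
have [|||h /setIP[Gh Ch] defP] := Sylow_trans (sylC _ sylP abP Pxg) (sylC (P :^ g)%G _ _ _).
- by rewrite pHallJ.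
- by rewrite /= abelianJ.
- by rewrite memJ_conjg.
have cPgh : g * h^-1 \in 'C(P).
  rewrite (subsetP sNC) // inE groupM ?groupV //=; apply/normP.
  by rewrite conjsgM defP conjsgK.
have /commgP : commute x (g * h^-1) by apply/commute_sym/(centP cPgh).
rewrite -conjg_fix conjgM => /eqP eqx; rewrite -{2}eqx.
have /commgP : commute (x ^ g) h^-1 by apply/commuteV/cent1P; rewrite cent1C.
by rewrite -conjg_fix => /eqP.
Qed.

(** The transfer to P kills G', since its target is abelian, and by the fusion
    lemma it acts on P as the power map of exponent #|G : P|, which is injective. *)
Lemma transfer_der1_TI p G P : p.-Sylow(G) P -> 'N_G(P) \subset 'C(P) ->
  P :&: G^`(1) = 1.
Proof.
move=> sylP sNC; have [sPG pP p'PG] := and3P sylP.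
have abP : abelian P by rewrite /abelian (subset_trans _ sNC) // subsetI sPG normG.
have abI : abelian (idm P @* P) by rewrite im_idm.
have memI x : x \in P -> x \in (idm P @* P)%G by rewrite /= im_idm.
apply/trivgP/subsetP=> g /setIP[Pg G'g]; apply/set1P.
have Gg := subsetP sPG _ Pg.
have ker_der : G^`(1) \subset 'ker (transfer_morphism G abI).
  apply: der1_min; first exact: ker_norm.
  by rewrite (isog_abelian (first_isog _)) FinRing.zmod_abelian.
have := mker (subsetP ker_der _ G'g).
have trX := transversalP (rcosets_cycle_partition sPG Gg).
rewrite /= (transfer_cycle_expansion sPG abI Gg trX).
set X := transversal _ _ in trX *.
rewrite (eq_bigr (fun x => FiniteModule.fmod abI g *+ #|<[g]> : P :* x|)%R); last first.
  move=> x Xx; have Gx := subsetP (transversal_sub trX) x Xx.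
  have Pgx : (g ^+ #|<[g]> : P :* x|) ^ x^-1 \in P.
    by rewrite conjgE invgK mulgA -mem_rcoset mulg_exp_card_rcosets.
  rewrite (Burnside_fusion sylP sNC) ?groupX ?groupV //= /restrm /=.
  by rewrite FiniteModule.fmodX ?memI.
rewrite GRing.sumrMnr (sum_index_rcosets_cycle sPG Gg trX).
rewrite -FiniteModule.fmodX ?memI // => fmod0.
have {}fmod0 : g ^+ #|G : P| = 1.
  have:= congr1 val fmod0; rewrite FiniteModule.fmodK ?memI ?groupX //.
have coP : coprime #|P| #|G : P| by rewrite (pnat_coprime pP).
by rewrite -(expgK coP Pg) fmod0 expg1n.
Qed.

Lemma der1_p'group p G P : p.-Sylow(G) P -> 'N_G(P) \subset 'C(P) ->
  p^'.-group G^`(1).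
Proof.
move=> sylP sNC.
have := Hall_setI_normal (der_normal 1 G) sylP.
rewrite (transfer_der1_TI sylP sNC) pHallE sub1G cards1 /= eq_sym partn_eq1 //.
Qed.

End ClassSize.

(** * Hall subgroups when the derived subgroup is a pi'-group *)

Section PiDerived.
Variables (gT : finGroupType) (pi : nat_pred).
Implicit Types G H K E X : {group gT}.

Lemma der1_p'quotient G : pi^'.-group G^`(1) ->
  abelian (G / 'O_pi^'(G)) /\ pi.-group (G / 'O_pi^'(G)).
Proof.
move=> pi'G'; have abQ : abelian (G / 'O_pi^'(G)).
  by rewrite sub_der1_abelian ?pcore_max ?der_normal.
split=> //; have := nilpotent_pcoreC pi^' (abelian_nil abQ).
rewrite trivg_pcore_quotient dprod1g => defQ.
by rewrite -pgroupNK -defQ pcore_pgroup.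
Qed.

(** G / 'O_pi^'(G) is an abelian pi-group, so 'O_pi^'(G) is a normal Hall subgroup
    and the Schur-Zassenhaus theorem applies. *)
Lemma der1_p'Hall G : pi^'.-group G^`(1) -> exists E : {group gT}, pi.-Hall(G) E.
Proof.
move=> pi'G'; have [_ piQ] := der1_p'quotient pi'G'.
have hallN : pi^'.-Hall(G) 'O_pi^'(G).
  rewrite /pHall pcore_sub pcore_pgroup -card_quotient ?gFnorm //=.
  by rewrite pnatNK.
have /splitsP[E /complP[tiNE defG]] :=
  SchurZassenhaus_split (pHall_Hall hallN) (pcore_normal _ _).
exists E; rewrite -[pi.-Hall(G) E]pHallNK.
have sEG : E \subset G by rewrite -defG mulG_subr.
rewrite pHallE sEG -(eqn_pmul2l (cardG_gt0 'O_pi^'(G))) -TI_cardMg // defG.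
by rewrite /= (card_Hall hallN) partnC.
Qed.

Lemma der1_p'sdprod G E : pi^'.-group G^`(1) -> pi.-Hall(G) E ->
  'O_pi^'(G) ><| E = G /\ abelian E.
Proof.
move=> pi'G' hallE; have [abQ piQ] := der1_p'quotient pi'G'.
have [sEG piE _] := and3P hallE.
have tiNE : 'O_pi^'(G) :&: E = 1 by apply/coprime_TIg/(p'nat_coprime (pcore_pgroup _ _) piE).
have nNE : E \subset 'N('O_pi^'(G)) by rewrite (subset_trans sEG) ?gFnorm.
have hallN : pi^'.-Hall(G) 'O_pi^'(G).
  rewrite /pHall pcore_sub pcore_pgroup -card_quotient ?gFnorm //=.
  by rewrite pnatNK.
split.
  rewrite sdprodE //; apply/eqP; rewrite eqEcard mul_subG ?pcore_sub //=.
  by rewrite TI_cardMg // (card_Hall hallN) (card_Hall hallE) mulnC partnC.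
rewrite (isog_abelian (quotient_isog nNE tiNE)).
exact: abelianS (quotientS _ sEG) abQ.
Qed.

(** Only the abelian complement needs to be solvable in the conjugacy part of the
    Schur-Zassenhaus theorem, which is applied inside the group generated by X and
    'O_pi^'(G). *)
Lemma der1_p'subJ G E X : pi^'.-group G^`(1) -> pi.-Hall(G) E ->
  X \subset G -> pi.-group X -> exists2 g, g \in 'O_pi^'(G) & X \subset E :^ g.
Proof.
move=> pi'G' hallE sXG piX; have [defG abE] := der1_p'sdprod pi'G' hallE.
have [_ defNE nNE tiNE] := sdprodP defG.
set N := 'O_pi^'(G) in defG defNE nNE tiNE *.
have nNX : X \subset 'N(N) by rewrite (subset_trans sXG) ?gFnorm.
have coNX : coprime #|N| #|X| by apply: p'nat_coprime (pcore_pgroup _ _) piX.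
pose E1 := (E :&: (N <*> X))%G.
have defNX : N * E1 = N * X.
  rewrite /= group_modl ?joing_subl // defNE -norm_joinEr //.
  by rewrite (setIidPr _) // join_subG pcore_sub.
have sE1E : E1 \subset E := subsetIl _ _.
have oX : #|X| = #|E1|.
  apply/eqP; rewrite -(eqn_pmul2l (cardG_gt0 N)) -TI_cardMg ?coprime_TIg // -defNX.
  by rewrite TI_cardMg //; apply/trivgP; rewrite -tiNE setIS.
have coNE1 : coprime #|N| #|E1| by rewrite -oX.
have [|||g Ng defX] := @SchurZassenhaus_trans_actsol _ [group of N] E1 X _ _ _ coNE1 (esym oX).
- exact: abelian_sol (abelianS sE1E abE).
- exact: subset_trans sE1E nNE.
- by rewrite joingC norm_joinEr ?(subset_trans sE1E nNE) //= defNX mulG_subr.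
by exists g; rewrite ?defX ?conjSg.
Qed.

(** The derived subgroup of 'C_G[x] is a pi'-group as well, so the centraliser has
    a Hall pi-subgroup, which here is one of G. *)
Lemma p'_class_Hall_cent G E x : pi^'.-group G^`(1) -> pi.-Hall(G) E ->
    x \in G -> pi^'.-nat #|x ^: G| ->
  exists2 g, g \in G & x \in 'C(E :^ g).
Proof.
move=> pi'G' hallE Gx pi'x.
have pi'C' : pi^'.-group ('C_G[x])^`(1) by apply: pgroupS (dergS 1 _) pi'G'; apply: subsetIl.
have [F hallF] := der1_p'Hall pi'C'.
have [sFC piF _] := and3P hallF.
have sFG : F \subset G := subset_trans sFC (subsetIl _ _).
have oF : #|F| = #|E|.
  rewrite (card_Hall hallF) (card_Hall hallE) -[in RHS](Lagrange (subsetIl G 'C[x])).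
  rewrite index_cent1 partnM ?cardG_gt0 // ?(part_p'nat pi'x) ?muln1 //.
  by rewrite -index_cent1 indexg_gt0.
have [g Ng sFE] := der1_p'subJ pi'G' hallE sFG piF.
exists g; first exact: subsetP (pcore_sub _ _) _ Ng.
have <- : F :=: E :^ g by apply/eqP; rewrite eqEcard sFE cardJg oF /=.
by rewrite -sub_cent1 (subset_trans sFC) ?subsetIr.
Qed.

End PiDerived.

Section Reduced.
Variable gT : finGroupType.
Implicit Types G H K P : {group gT}.

(** Otherwise the conjugates of the centraliser of a Sylow p-subgroup P cover G,
    so P is central, and the transfer makes it meet G' trivially. *)
Lemma reduced_vertex G p : reduced_group G -> p \in \pi(G) ->
  exists2 x, x \in G & p %| #|x ^: G|.
Proof.
move=> redG; rewrite mem_primes => /and3P[p_pr _ pG].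
case: (boolP [exists x in G, p %| #|x ^: G|]) => [/exists_inP//|nex].
have [P sylP] := Sylow_exists p G; have [sPG _] := andP sylP.
have cov : G \subset class_support 'C_G(P) G.
  apply/subsetP=> x Gx; apply: (p'_class_sub_cent p_pr sylP Gx).
  by apply: contra nex => px; apply/exists_inP; exists x.
have cPG : G \subset 'C(P).
  exact/setIidPl/(class_support_proper (subsetIl G 'C(P)) cov).
have nPG : P <| G by rewrite /normal sPG (subset_trans cPG) ?cent_sub.
have P1 : P :=: 1.
  apply: redG nPG _; rewrite setIC; apply: transfer_der1_TI sylP _.
  by rewrite subIset ?cPG.
have := card_Hall sylP; rewrite P1 cards1 p_part => /eqP.
by rewrite eq_sym -(expn0 p) eqn_exp2l ?prime_gt1 // eqn0Ngt logn_gt0 mem_primes p_pr pG cardG_gt0.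
Qed.

End Reduced.

(** * Coprime action and the Fitting subgroup *)

Section Coprime.
Variable gT : finGroupType.
Implicit Types G H K L Y Z : {group gT}.

Lemma sub_setU_group G H K : G \subset H :|: K -> (G \subset H) || (G \subset K).
Proof.
move=> sGHK; apply/norP => -[/subsetPn[x Gx nHx] /subsetPn[y Gy nKy]].
have Kx : x \in K by have := subsetP sGHK x Gx; rewrite inE (negPf nHx).
have Hy : y \in H by have := subsetP sGHK y Gy; rewrite inE (negPf nKy) orbF.
have := subsetP sGHK _ (groupM Gx Gy).
by rewrite inE groupMr // (negPf nHx) groupMl // (negPf nKy).
Qed.

(** K is the product of 'C_K(Y) and of a Y-invariant Sylow s-subgroup S, so every
    commutator [~ k, y] already lies in S. *)
Lemma prime_power_index_comm_Fitting (s : nat) K Y :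
    Y \subset 'N(K) -> coprime #|K| #|Y| -> solvable Y ->
  s.-nat #|K : 'C_K(Y)| -> [~: K, Y] \subset 'F(K).
Proof.
move=> nKY coKY solY sidx.
have [S sylS nSY] := sol_coprime_Sylow_exists s solY nKY coKY.
have [sSK sS s'S] := and3P sylS.
have defK : 'C_K(Y) * S = K.
  by apply: coprime_index_mulG; rewrite ?subsetIl // (pnat_coprime sidx).
have sKYS : [~: K, Y] \subset S.
  rewrite gen_subG; apply/subsetP=> _ /imset2P[k y Kk Yy ->].
  move: Kk; rewrite -{1}defK => /mulsgP[c x /setIP[_ cYc] Sx ->].
  have /commgP/eqP cy : commute c y by apply: (centP cYc).
  by rewrite commMgJ cy conj1g mul1g (subsetP _ _ (mem_commg Sx Yy)) // commg_subl.
apply: Fitting_max; last exact: pgroup_nil (pgroupS sKYS sS).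
by rewrite /normal commg_norml commg_subl nKY.
Qed.

(** A proper subgroup of L is subnormal, so it lies in a proper normal subgroup
    N; then L / N would be perfect. *)
Lemma nilpotent_mul_der1 L H : nilpotent L -> H \subset L ->
  L \subset L^`(1) * H -> H :=: L.
Proof.
move=> nilL sHL sL.
have [//|[N [snHN nNL pNL]]] := subnormalEr (nilpotent_subnormal nilL sHL).
have solL := nilpotent_sol nilL.
have nLN := normal_norm nNL.
have sQ : L / N \subset (L / N)^`(1).
  rewrite -(quotient_der 1 nLN) (subset_trans (quotientS _ sL)) //.
  by rewrite (quotientMl _ (subset_trans (der_sub 1 L) nLN)) (quotientS1 (subnormal_sub snHN)) mulg1.
case: (eqsVneq (L / N) 1) => [/eqP|nt].
  by rewrite -subG1 quotient_sub1 // (negPf (proper_subn pNL)).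
by have := sol_der1_proper (quotient_sol N solL) (subxx _) nt; rewrite properE sQ andbF.
Qed.

Lemma coprime_nil_cent_der1 L Y : nilpotent L -> Y \subset 'N(L) ->
  coprime #|L| #|Y| -> L / L^`(1) \subset 'C(Y / L^`(1)) -> L \subset 'C(Y).
Proof.
move=> nilL nLY coLY cQ; have solL := nilpotent_sol nilL.
have nL'Y : Y \subset 'N(L^`(1)) by rewrite (gFnorm_trans _ nLY).
have := coprime_quotient_cent (der_sub 1 L) nL'Y coLY solL.
rewrite (setIidPl cQ) => /esym eqQ.
apply/setIidPl/(nilpotent_mul_der1 nilL (subsetIl _ _)).
by rewrite -quotientSK ?gFnorm ?eqQ.
Qed.

(** By coprimality the fixed points of Y on K / 'F(K), which is centralised by Y,
    lift to fixed points on K. *)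
Lemma coprime_Fitting_cent K Y :
    Y \subset 'N(K) -> coprime #|K| #|Y| ->
  [~: K, Y] \subset 'F(K) -> 'F(K) \subset 'C(Y) -> K \subset 'C(Y).
Proof.
move=> nKY coKY sKYF cFY; have solF := nilpotent_sol (Fitting_nil K).
have nFY : Y \subset 'N('F(K)) by rewrite gFnorm_trans.
have := coprime_norm_quotient_cent nKY nFY (coprimeSg (Fitting_sub K) coKY) solF.
have -> : 'C_(K / 'F(K))(Y / 'F(K)) = K / 'F(K).
  by apply/setIidPl; rewrite quotient_cents2r.
move/esym=> eqQ; have : K \subset 'F(K) * 'C_K(Y).
  by rewrite -quotientSK ?gFnorm // eqQ.
move/subset_trans; apply; rewrite mul_subG ?subsetIr //.
Qed.

End Coprime.

(** * Normal subgroups with an abelian Hall complement *)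

Lemma cent1_coprimeM (gT : finGroupType) (x y : gT) :
  commute x y -> coprime #[x] #[y] -> 'C[x * y] = 'C[x] :&: 'C[y].
Proof. by move=> cxy co_xy; rewrite -!cent_cycle cycleM // centM. Qed.

Section AbelianComplement.
Variable gT : finGroupType.
Variables G K B : {group gT}.
Hypotheses (defG : K ><| B = G) (abB : abelian B) (coKB : coprime #|K| #|B|).
Implicit Type W : {group gT}.

Let sKG : K \subset G. Proof. by case/sdprod_context: defG => /andP[]. Qed.
Let sBG : B \subset G. Proof. by case/sdprod_context: defG. Qed.
Let nKB : B \subset 'N(K). Proof. by case/sdprodP: defG. Qed.
Let defKB : K * B = G. Proof. by case/sdprodP: defG. Qed.

(** B centralises W, so the B-part of a conjugating element has no effect. *)
Lemma compl_conj W g : W \subset B -> g \in G ->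
  exists2 k, k \in K & W :^ g = W :^ k.
Proof.
move=> sWB; rewrite -defKB -(normC nKB) => /mulsgP[b k Bb Kk ->].
exists k => //; rewrite conjsgM; congr (_ :^ _); apply/normP.
by rewrite (subsetP (cent_sub _)) // (subsetP (centS sWB)) // (subsetP abB).
Qed.

Lemma compl_cent1M x y : x \in K -> y \in B -> commute x y ->
  'C[x * y] = 'C[x] :&: 'C[y].
Proof.
move=> Kx By cxy; apply: cent1_coprimeM => //.
by rewrite (coprime_dvdl (order_dvdG Kx)) ?(coprime_dvdr (order_dvdG By)).
Qed.

Lemma compl_subcent1 y : y \in B -> 'C_K[y] * B = 'C_G[y].
Proof.
move=> By; have sBC : B \subset 'C[y] by rewrite sub_cent1 (subsetP abB).
by rewrite setIC group_modr //= defKB setIC.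
Qed.

Lemma compl_class_size y : y \in B -> #|y ^: G| = #|K : 'C_K[y]|.
Proof.
move=> By; rewrite -index_cent1; apply/eqP.
rewrite -(eqn_pmul2l (cardG_gt0 'C_G[y])) /= Lagrange ?subsetIl //.
have co1 : coprime #|'C_K[y]| #|B| by apply: coprimeSg coKB; apply: subsetIl.
rewrite -(compl_subcent1 By) (coprime_cardMg co1) mulnAC Lagrange ?subsetIl //.
by rewrite -(coprime_cardMg coKB) defKB.
Qed.

(** The centraliser of x * y is contained in that of y, so a conjugate of W that
    commutes with x * y is conjugate to W within 'C_G[y], even by an element of
    'C_K[y].  The conjugates of the centraliser of W in 'C_K[y] thus cover 'C_K[y]. *)
Lemma compl_cent_Hall pi W y : y \in B -> W \subset B -> pi.-Hall(G) W ->
    pi^'.-group G^`(1) ->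
    {in 'C_K[y], forall x, pi^'.-nat #|(x * y) ^: G|} ->
  'C_K[y] \subset 'C(W).
Proof.
move=> By sWB hallW pi'G' pi'class; have Gy := subsetP sBG y By.
apply/setIidPl/(class_support_proper (subsetIl _ _))/subsetP=> x /[dup] Cx /setIP[Kx cyx].
have cxy : commute x y by apply/cent1P.
have Gxy : x * y \in G by rewrite groupM // (subsetP sKG).
have [g Gg] := p'_class_Hall_cent pi'G' hallW Gxy (pi'class x Cx).
rewrite -sub_cent1 compl_cent1M // subsetI => /andP[sWgx sWgy].
have sBCy : B \subset 'C_G[y] by rewrite subsetI sBG sub_cent1 (subsetP abB).
have pi'C' : pi^'.-group ('C_G[y])^`(1).
  by apply: pgroupS pi'G'; apply: dergS; apply: subsetIl.
have hallWC : pi.-Hall('C_G[y]) W.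
  by apply: pHall_subl hallW; rewrite ?subsetIl // (subset_trans sWB).
have sWgC : W :^ g \subset 'C_G[y] by rewrite subsetI sWgy conj_subG // (subset_trans sWB).
have [|h /(subsetP (pcore_sub _ _)) Ch sWgh] := @der1_p'subJ _ _ _ _ (W :^ g)%G pi'C' hallWC sWgC.
  by rewrite /= pgroupJ; case/and3P: hallW.
have nCB : B \subset 'N('C_K[y]).
  by rewrite normsI // (subset_trans _ (normG _)) // sub_cent1 (subsetP abB).
move: Ch; rewrite /= -(compl_subcent1 By) -(normC nCB) => /mulsgP[b c Bb Cc def_h].
have defWg : W :^ g = W :^ c.
  apply/eqP; rewrite eqEcard !cardJg leqnn andbT (subset_trans sWgh) // def_h conjsgM.
  rewrite (normsP _ b Bb) // (subset_trans abB) // (subset_trans (centS sWB)) ?cent_sub //.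
rewrite -[x](conjgKV c) memJ_class_support // inE groupJ ?groupV //=.
by rewrite -mem_conjg -centJ -defWg -sub_cent1.
Qed.

End AbelianComplement.

(** * Separated sets of primes with Hall subgroups *)

(** Arithmetic form of the absence of edges between pi and the other vertices
    distinct from s: a class size divisible by a prime of pi involves no prime
    outside pi and s. *)
Definition class_sep (gT : finGroupType) (G : {group gT}) (s : nat) (pi : nat_pred) :=
  {in G, forall x, pi^'.-nat #|x ^: G| || [predU1 s & pi].-nat #|x ^: G|}.

Lemma pnat_predU1 (s : nat) (pi : nat_pred) n :
  [predU1 s & pi].-nat n -> pi^'.-nat n -> s.-nat n.
Proof.
move=> Un pi'n; have: [predI [predU1 s & pi] & pi^'].-nat n by rewrite pnatI Un.
by apply: sub_in_pnat => p _ /andP[/predU1P[-> _|pi_p /negP[]//]]; rewrite inE.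
Qed.

Section TwoSeparatedHall.
Variable gT : finGroupType.
Variables G K D : {group gT}.
Hypotheses (defG : K ><| D = G) (abD : abelian D) (coKD : coprime #|K| #|D|).
Hypothesis regD : 'C_D(K) = 1.
Implicit Types A E : {group gT}.

Let sKG : K \subset G. Proof. by case/sdprod_context: defG => /andP[]. Qed.
Let sDG : D \subset G. Proof. by case/sdprod_context: defG. Qed.
Let nKD : D \subset 'N(K). Proof. by case/sdprodP: defG. Qed.

(** If the index of 'C_K[y] were not a power of t, then no class size n(x * y) with
    x in 'C_K[y] would involve delta, so E would centralise 'C_K[y], which contains
    'C_K(A).  The conjugates of 'C_K(E) alone would then cover K. *)
Lemma separated_comm_Fitting (t : nat) (delta : nat_pred) A E y :
    A \subset D -> E \subset D -> delta.-Hall(G) E -> E :!=: 1 ->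
    delta^'.-group G^`(1) -> delta^'.-group K -> class_sep G t delta ->
    {in K, forall x, exists2 g, g \in G & (x \in 'C(A :^ g)) || (x \in 'C(E :^ g))} ->
  y \in A -> [~: K, <[y]>] \subset 'F(K).
Proof.
move=> sAD sED hallE ntE delta'G' delta'K sep cov Ay.
have Dy := subsetP sAD y Ay.
have nKY : <[y]> \subset 'N(K) by rewrite cycle_subG (subsetP nKD).
have coKY : coprime #|K| #|<[y]>| by rewrite (coprimegS _ coKD) ?cycle_subG.
apply: (@prime_power_index_comm_Fitting _ t) => //.
  exact/abelian_sol/cycle_abelian.
rewrite cent_cycle; apply: contraR ntE => t'y.
have cCE : 'C_K[y] \subset 'C(E).
  apply: (compl_cent_Hall defG) hallE delta'G' _ => // x /setIP[Kx cyx].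
  have cxy : commute x y by apply/cent1P.
  have Gxy : x * y \in G by rewrite groupM ?(subsetP sKG x) ?(subsetP sDG y).
  have [//|Uxy] := orP (sep _ Gxy); case/negP: t'y.
  have dvd_y : #|K : 'C_K[y]| %| #|(x * y) ^: G|.
    rewrite -(compl_class_size defG) // -!index_cent1 (compl_cent1M coKD) //.
    by rewrite indexgS // setIS // subsetIr.
  apply: pnat_predU1 (pnat_dvd dvd_y Uxy) _.
  exact: pnat_dvd (dvdn_indexg _ _) delta'K.
have defK : 'C_K(E) = K.
  apply: class_support_proper (subsetIl _ _) _; apply/subsetP=> x Kx.
  have [g Gg] := cov x Kx; case/orP.
    have [k Kk ->] := compl_conj defG abD sAD Gg.
    rewrite centJ mem_conjg => cAx; rewrite -[x](conjgKV k) memJ_class_support // inE groupJ ?groupV //=.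
    by rewrite (subsetP cCE) // inE groupJ ?groupV //= -cent_set1 (subsetP (centS _) _ cAx) ?sub1set.
  have [k Kk ->] := compl_conj defG abD sED Gg.
  rewrite centJ mem_conjg => cEx; rewrite -[x](conjgKV k) memJ_class_support //.
  by rewrite inE groupJ ?groupV.
by rewrite -subG1 -regD subsetI sED centsC -defK subsetIr.
Qed.

(** y and y ^ k differ by [~ y, k], an element of 'F(K), and so they have the same
    action on the abelian group 'F(K) / 'F(K)'. *)
Lemma Fitting_quotient_cent (Y : {set gT}) x y k : <[y]> \subset 'N(K) ->
    [~: K, <[y]>] \subset 'F(K) ->
    x \in 'F(K) -> k \in K -> y \in Y -> x \in 'C(Y :^ k) ->
  coset 'F(K)^`(1) x \in 'C[coset 'F(K)^`(1) y].
Proof.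
set L := 'F(K)%G => nKy sKyL Lx Kk Yy cYx.
have nL'y : y \in 'N(L^`(1)).
  by rewrite -cycle_subG !gFnorm_trans.
have nL'L := subsetP (der_norm 1 L).
have Lz : [~ y, k] \in L.
  by apply: (subsetP sKyL); rewrite commGC mem_commg ?cycle_id.
have cxyk : commute x (y * [~ y, k]).
  by rewrite -conjg_mulR; apply: (centP cYx); rewrite memJ_conjg.
have cQ : abelian (L / L^`(1)) by apply: sub_der1_abelian.
have cxz : commute (coset L^`(1) x) (coset L^`(1) [~ y, k]).
  by apply: (centsP cQ); rewrite mem_quotient.
have cxyz : commute (coset L^`(1) x) (coset L^`(1) y * coset L^`(1) [~ y, k]).
  have nL'x := nL'L x Lx; have nL'z := nL'L _ Lz.
  by rewrite /commute -!morphM ?(groupM nL'y nL'z) //; congr (coset _ _).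
apply/cent1P; rewrite -[coset _ y](mulgK (coset L^`(1) [~ y, k])).
by apply: commuteM => //; apply: commuteV.
Qed.

(** Let y and e be nontrivial elements of A and E.  Modulo its derived subgroup,
    'F(K) is the union of the fixed points of y and of those of e, so one of the two
    acts trivially there, hence on 'F(K) and finally on K. *)
Lemma no_two_separated_Hall (r t : nat) (alpha delta : nat_pred) A E :
    A \subset D -> alpha.-Hall(G) A -> A :!=: 1 ->
    E \subset D -> delta.-Hall(G) E -> E :!=: 1 ->
    alpha^'.-group G^`(1) -> delta^'.-group G^`(1) ->
    alpha^'.-group K -> delta^'.-group K ->
    (forall p, p \in alpha -> p \notin [predU1 t & delta]) ->
    (forall p, p \in delta -> p \notin [predU1 r & alpha]) ->
  class_sep G r alpha -> class_sep G t delta -> False.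
Proof.
move=> sAD hallA ntA sED hallE ntE alpha'G' delta'G' alpha'K delta'K tiAD tiDA sepA sepE.
have cov : {in G, forall x, exists2 g, g \in G & (x \in 'C(A :^ g)) || (x \in 'C(E :^ g))}.
  move=> x Gx; case/orP: (sepA x Gx) => [alpha'x | Ux].
    by have [g Gg cx] := p'_class_Hall_cent alpha'G' hallA Gx alpha'x; exists g; rewrite ?cx.
  have delta'x : delta^'.-nat #|x ^: G|.
    by apply: sub_in_pnat Ux => p _ Up; apply: contraL Up => /tiDA.
  by have [g Gg cx] := p'_class_Hall_cent delta'G' hallE Gx delta'x; exists g; rewrite ?cx ?orbT.
have covK : {in K, forall x, exists2 g, g \in G & (x \in 'C(A :^ g)) || (x \in 'C(E :^ g))}.
  by move=> x Kx; apply: cov; apply: (subsetP sKG).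
have covK' : {in K, forall x, exists2 g, g \in G & (x \in 'C(E :^ g)) || (x \in 'C(A :^ g))}.
  by move=> x /covK[g Gg]; rewrite orbC; exists g.
have [y Ay nty] := trivgPn _ ntA; have [e Ee nte] := trivgPn _ ntE.
have Dy := subsetP sAD y Ay; have De := subsetP sED e Ee.
have sKyF := separated_comm_Fitting sAD sED hallE ntE delta'G' delta'K sepE covK Ay.
have sKeF := separated_comm_Fitting sED sAD hallA ntA alpha'G' alpha'K sepA covK' Ee.
have norm_cyc d : d \in D -> <[d]> \subset 'N(K) by rewrite cycle_subG; apply/subsetP.
have trivial_cent d : d \in D -> [~: K, <[d]>] \subset 'F(K) ->
    'F(K) / 'F(K)^`(1) \subset 'C[coset 'F(K)^`(1) d] -> d = 1.
  move=> Dd sKdF cQd; have nKd := norm_cyc d Dd.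
  have coKd : coprime #|K| #|<[d]>| by rewrite (coprimegS _ coKD) ?cycle_subG.
  have nL'd : d \in 'N('F(K)^`(1)) by rewrite -cycle_subG !gFnorm_trans.
  have cFd : 'F(K) \subset 'C(<[d]>).
    apply: coprime_nil_cent_der1 (Fitting_nil K) _ _ _.
    - by rewrite gFnorm_trans.
    - exact: coprimeSg (Fitting_sub K) coKd.
    by rewrite quotient_cycle // cent_cycle.
  have /centsP cKd := coprime_Fitting_cent nKd coKd sKdF cFd.
  apply/set1gP; rewrite -regD inE Dd; apply/centP=> k Kk.
  by apply/commute_sym/cKd; rewrite ?cycle_id.
have : 'F(K) / 'F(K)^`(1) \subset 'C[coset 'F(K)^`(1) y] :|: 'C[coset 'F(K)^`(1) e].
  apply/subsetP=> _ /morphimP[x nL'x Fx ->]; have Kx := subsetP (Fitting_sub K) x Fx.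
  have [g Gg] := covK x Kx; rewrite inE; case/orP.
    have [k Kk ->] := compl_conj defG abD sAD Gg => cx.
    by rewrite (Fitting_quotient_cent _ sKyF Fx Kk Ay cx) ?norm_cyc.
  have [k Kk ->] := compl_conj defG abD sED Gg => cx.
  by rewrite (Fitting_quotient_cent _ sKeF Fx Kk Ee cx) ?norm_cyc ?orbT.
case/sub_setU_group/orP => /trivial_cent.
  by move/(_ Dy sKyF)/eqP; apply/negP.
by move/(_ De sKeF)/eqP; apply/negP.
Qed.

End TwoSeparatedHall.

Lemma commute_conjg (gT : finGroupType) (x y : gT) : commute x y -> x ^ y = x.
Proof. by move/commgP; rewrite -conjg_fix => /eqP. Qed.

Section Index.
Variable gT : finGroupType.
Implicit Types G H K C W X : {group gT}.

(** In particular the class sizes of a normal subgroup divide those of the group. *)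
Lemma dvdn_index_normal G K C : K <| G -> C \subset G ->
  #|K : C| %| #|G : C|.
Proof.
move=> /andP[sKG nKG] sCG.
have nKC : C \subset 'N(K) := subset_trans sCG nKG.
rewrite -(@Lagrange_index _ G (C <*> K) C) ?joing_subl ?join_subG ?sCG //.
by rewrite /= norm_joinEl // indexMg dvdn_mull.
Qed.

Lemma pi_sub_p'index pi X C W : C \subset X -> W <| X ->
  pi.-group W -> pi^'.-nat #|X : C| -> W \subset C.
Proof.
move=> sCX nsWX piW pi'XC; rewrite -indexg_eq1; apply/eqP/(@pnat_1 pi).
  exact: pnat_dvd (dvdn_indexg _ _) piW.
exact: pnat_dvd (dvdn_index_normal nsWX sCX) pi'XC.
Qed.

End Index.

Section AbelianKernel.
Variables (gT : finGroupType) (beta : nat_pred).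
Variables G K B : {group gT}.
Hypotheses (defG : K ><| B = G) (abB : abelian B) (coKB : coprime #|K| #|B|).

Let sKG : K \subset G. Proof. by case/sdprod_context: defG => /andP[]. Qed.
Let nsKG : K <| G. Proof. by case/sdprod_context: defG. Qed.
Let sBG : B \subset G. Proof. by case/sdprod_context: defG. Qed.
Let nKB : B \subset 'N(K). Proof. by case/sdprodP: defG. Qed.
Let defKB : K * B = G. Proof. by case/sdprodP: defG. Qed.

(** The left-hand side is central in G and G' is contained in K. *)
Lemma reduced_compl_regular : reduced_group G -> 'C_B(K) = 1.
Proof.
move=> redG; have cCG : 'C_B(K) \subset 'Z(G).
  rewrite subsetI subIset ?sBG //= -defKB centM subsetI subsetIr /=.
  by rewrite (subset_trans (subsetIl _ _)).
apply: redG (sub_center_normal cCG) _.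
apply/trivgP; have [_ _ _ <-] := sdprodP defG.
rewrite setISS ?subsetIl // der1_min ?(normal_norm nsKG) //.
by rewrite -(isog_abelian (sdprod_isog defG)).
Qed.

(** G' is contained in [~: K, B], which meets 'C_K(B) trivially by coprime action on
    the abelian group K. *)
Lemma reduced_kernel_regular : reduced_group G -> abelian K -> 'C_K(B) = 1.
Proof.
move=> redG abK; have cCG : 'C_K(B) \subset 'Z(G).
  rewrite subsetI subIset ?sKG //= -defKB centM subsetI subsetIr andbT.
  by rewrite (subset_trans (subsetIl _ _)).
apply: redG (sub_center_normal cCG) _; apply/trivgP.
rewrite -(coprime_abel_cent_TI nKB coKB abK) setISS ?subsetIr //.
have [nK nB] : K \subset 'N([~: K, B]) /\ B \subset 'N([~: K, B]).
  by rewrite commg_norml commg_normr.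
apply: der1_min; first by rewrite -defKB mul_subG.
rewrite -defKB quotientMl // /abelian centM subsetI !mul_subG ?(quotient_cents _ abK) ?(quotient_cents _ abB) //.
all: by rewrite quotient_cents2 // ?subxx // commGC.
Qed.

(** The centraliser of u * y is the semidirect product of 'C_K[y] and 'C_B[u]. *)
Lemma compl_class_sizeM u y : abelian K -> u \in K -> y \in B -> commute u y ->
  #|(u * y) ^: G| = (#|K : 'C_K[y]| * #|B : 'C_B[u]|)%N.
Proof.
move=> abK Ku By cuy; rewrite -index_cent1 (compl_cent1M coKB Ku By cuy).
have sCC : 'C_K[y] \subset 'C[u].
  by rewrite sub_cent1 (subsetP (centS (subsetIl _ _))) // (subsetP abK).
have defC : 'C_K[y] * 'C_B[u] = G :&: ('C[u] :&: 'C[y]).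
  by rewrite group_modl // (compl_subcent1 defG abB By) -setIA [_ :&: 'C[u]]setIC.
rewrite -defC; apply/eqP.
have co1 : coprime #|'C_K[y]| #|'C_B[u]|.
  by rewrite (coprimeSg _ (coprimegS _ coKB)) ?subsetIl.
rewrite defC -(eqn_pmul2l (cardG_gt0 [group of G :&: ('C[u] :&: 'C[y])])) /=.
rewrite Lagrange ?subsetIl // -defC (coprime_cardMg co1) mulnACA.
by rewrite !Lagrange ?subsetIl // -(coprime_cardMg coKB) defKB.
Qed.

(** The beta'-part of x lies in K, and its beta-part in a conjugate of B. *)
Lemma compl_decomp x : beta^'.-group G^`(1) -> beta.-Hall(G) B -> x \in G ->
  exists u y, [/\ u \in K, y \in B, commute u y & x ^: G = (u * y) ^: G].
Proof.
move=> beta'G' hallB Gx.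
have hallK : beta^'.-Hall(G) K by apply/(sdprod_normal_pHallP nsKG hallB).
have sXG : <[x.`_beta]> \subset G by rewrite cycle_subG groupX.
have [|g Ng] := der1_p'subJ beta'G' hallB sXG.
  by rewrite /pgroup -/(_.-elt _) p_elt_constt.
have Gg := subsetP (pcore_sub _ _) g Ng.
rewrite cycle_subG mem_conjg => Bxg.
exists (x.`_beta^' ^ g^-1), (x.`_beta ^ g^-1); split=> //.
- rewrite memJ_norm ?groupV ?(subsetP (normal_norm nsKG)) //.
  by rewrite (mem_normal_Hall hallK nsKG) ?p_elt_constt // groupX.
- by rewrite /commute -!conjMg (commuteX2 _ _ (commute_refl x)).
have := consttC beta^' x; rewrite consttNK -conjMg => ->.
by rewrite classGidl ?groupV.
Qed.

End AbelianKernel.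

Section KernelAbelian.
Variable gT : finGroupType.
Variables G K B : {group gT}.
Hypotheses (defG : K ><| B = G) (abB : abelian B).
Hypothesis regB : 'C_B(K) = 1.

Let sKG : K \subset G. Proof. by case/sdprod_context: defG => /andP[]. Qed.
Let nsKG : K <| G. Proof. by case/sdprod_context: defG. Qed.

(** An element of K that commutes with no conjugate of E is central in K, because its
    class size in K divides both a (t, delta)-number and the order of K.  This
    yields K = 'C_K(E) * 'Z(K).  Multiplying an element c of 'C_K(E) by a central
    element z outside 'C(E) gives an element that commutes with no conjugate of E, so
    that c is central too. *)
Lemma separated_kernel_abelian (t : nat) (delta : nat_pred) (E : {group gT}) :
    E \subset B -> E :!=: 1 -> delta.-Hall(G) E -> delta^'.-group G^`(1) ->
    [predU1 t & delta]^'.-group K -> class_sep G t delta ->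
  abelian K.
Proof.
move=> sEB ntE hallE delta'G' t'K sep.
have cov x : x \in K -> x \in 'Z(K) \/ exists2 k, k \in K & x \in 'C(E :^ k).
  move=> Kx; have Gx := subsetP sKG x Kx.
  have [delta'x | Ux] := orP (sep x Gx).
    have [g Gg cx] := p'_class_Hall_cent delta'G' hallE Gx delta'x.
    have [k Kk defEg] := compl_conj defG abB sEB Gg.
    by right; exists k; rewrite -?defEg.
  left; rewrite inE Kx /= -sub_cent1.
  suffices: K \subset 'C_G[x] by rewrite subsetI => /andP[].
  rewrite -indexg_eq1; apply/eqP/(@pnat_1 [predU1 t & delta]).
    apply: pnat_dvd Ux; rewrite -index_cent1.
    by apply: dvdn_index_normal; rewrite ?subsetIl.
  exact: pnat_dvd (dvdn_indexg _ _) t'K.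
have ntCE : ~~ (K \subset 'C(E)).
  apply: contra ntE => cKE.
  by rewrite -subG1 -regB subsetI sEB centsC.
pose C := 'C_K(E); pose Z := 'Z(K).
have cCZ : Z \subset 'C(C) by rewrite (subset_trans (subsetIr _ _)) ?centS ?subsetIl.
have defK : C * Z = K.
  rewrite -cent_joinEr //; apply: class_support_proper.
    by rewrite join_subG !subsetIl.
  apply/subsetP=> x Kx; case: (cov x Kx) => [Zx | [k Kk]].
    by rewrite mem_class_support // (subsetP (joing_subr _ _)).
  rewrite centJ mem_conjg => cEx; rewrite -[x](conjgKV k) memJ_class_support //.
  by rewrite (subsetP (joing_subl _ _)) // inE groupJ ?groupV.
have /subsetPn[z Zz nEz] : ~~ (Z \subset 'C(E)).
  apply: contra ntCE => cEZ; rewrite -defK mul_subG ?subsetIr //.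
have [Kz cKz] := setIP Zz.
rewrite /abelian -{1}defK mul_subG ?subsetIr //.
apply/subsetP=> c /[dup] Cc /setIP[Kc cEc].
case: (cov (c * z)); first by rewrite groupM.
  by case/setIP=> _; rewrite groupMr.
case=> k Kk; rewrite centJ mem_conjg conjMg [z ^ _](_ : _ = z); last first.
  by apply/commute_conjg/(centP cKz); rewrite groupV.
rewrite groupMl ?(negPf nEz) //.
rewrite -groupV in Kk; move: Kk; rewrite -{1}defK => /mulsgP[c1 z1 Cc1 Zz1 ->].
rewrite conjgM [(c ^ c1) ^ z1](_ : _ = c ^ c1).
  by rewrite groupJ //; case/setIP: Cc1.
apply/commute_conjg/commute_sym; case/setIP: Zz1 => _ /centP; apply.
by rewrite groupJ //; case/setIP: Cc1.
Qed.

End KernelAbelian.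

(** * Centre, Frobenius quotient and Fitting subgroup *)

Section FrobeniusQuotient.
Variable gT : finGroupType.
Variables A B H : {group gT}.
Hypotheses (defH : A * B = H) (nAB : B \subset 'N(A)) (coAB : coprime #|A| #|B|).
Hypothesis (abB : abelian B).

Lemma center_sdprod_cent : abelian A -> 'C_A(B) = 1 -> 'Z(H) = 'C_B(A).
Proof.
move=> abA regA; apply/setP=> z; apply/setIP/setIP=> [[] | [Bz cAz]].
  rewrite -defH centM => /mulsgP[a b Aa Bb ->] /setIP[cA cB].
  have cBa : a \in 'C(B) by rewrite -(groupMr _ (subsetP abB b Bb)).
  have a1 : a = 1 by apply/set1gP; rewrite -regA inE Aa.
  by rewrite a1 mul1g in cA *.
split; first by rewrite -defH -[z]mul1g mem_mulg.
by rewrite -defH centM inE cAz (subsetP abB).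
Qed.

(** If the images of a in A and b in B commute, then [~ a, b] lies in both 'Z(H) and
    A, hence is trivial. *)
Lemma Frobenius_quotient_center :
    'Z(H) = 'C_B(A) -> 'Z(H) \proper B -> A :!=: 1 ->
    {in B, forall b, b \notin 'Z(H) -> 'C_A[b] = 1} ->
  [Frobenius H / 'Z(H) with kernel (A * 'Z(H)) / 'Z(H)].
Proof.
move=> defZ pZB ntA regA; rewrite quotientMidr.
have sZB := proper_sub pZB.
have nZH : H \subset 'N('Z(H)) by rewrite gFnorm.
have sAH : A \subset H by rewrite -defH mulG_subl.
have sBH : B \subset H by rewrite -defH mulG_subr.
have tiAB := coprime_TIg coAB.
have tiAZ : 'Z(H) :&: A = 1.
  by apply/trivgP; rewrite -tiAB [A :&: B]setIC setSI.
apply/existsP; exists (B / 'Z(H))%G.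
have ntAQ : A / 'Z(H) != 1.
  rewrite -subG1 quotient_sub1 ?(subset_trans sAH nZH) //.
  by apply: contra ntA => sAZ; rewrite -(setIidPl sAZ) setIC tiAZ.
have ntBQ : B / 'Z(H) != 1.
  by rewrite -subG1 quotient_sub1 ?(subset_trans sBH nZH) // proper_subn.
apply/Frobenius_semiregularP => //.
  rewrite sdprodE ?quotient_norms //; last by rewrite coprime_TIg ?coprime_morph.
  by rewrite -quotientMl ?(subset_trans sAH nZH) // defH.
move=> bb /setD1P[ntbb /morphimP[b nZb Bb def_bb]].
apply/trivgP/subsetP=> aa /setIP[/morphimP[a nZa Aa ->]].
rewrite def_bb in ntbb *; rewrite cent1C => /cent1P cab; apply/set1gP.
have nZb' : b \notin 'Z(H).
  by apply: contra ntbb => Zb; rewrite /= coset_id.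
suffices a1 : a = 1 by rewrite a1 morph1.
apply/set1gP; rewrite -(regA b Bb nZb') inE Aa /=.
apply/cent1P/commgP/eqP/set1gP; rewrite -tiAZ inE andbC.
rewrite (subsetP _ _ (mem_commg Aa Bb)) ?commg_subl //=.
by rewrite coset_idr ?groupR // morphR //; apply/eqP/commgP.
Qed.

(** The part of 'F(G) inside B has order prime to K, so in the nilpotent group
    'F(G) it commutes with K. *)
Lemma Fitting_abelian_kernel (G K : {group gT}) : K ><| B = G -> abelian K -> coprime #|K| #|B| ->
  'C_B(K) = 1 -> 'F(G) = K.
Proof.
move=> defG abK coKB regB; have [nsKG sBG defKB _ _] := sdprod_context defG.
have sKF : K \subset 'F(G) by rewrite Fitting_max ?abelian_nil.
have cQK : 'F(G) :&: B \subset 'C(K).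
  apply: sub_nilpotent_cent2 (Fitting_nil G) sKF (subsetIl _ _) _.
  by rewrite (coprimegS _ coKB) ?subsetIr.
apply/eqP; rewrite eqEsubset sKF andbT.
have -> : 'F(G) = K * (B :&: 'F(G)).
  by rewrite group_modl // defKB (setIidPr (Fitting_sub G)).
rewrite mul_subG //= (_ : B :&: 'F(G) = 1) ?sub1G //.
by apply/trivgP; rewrite /= setIC -regB subsetI subsetIr.
Qed.

End FrobeniusQuotient.

(** * From class sizes to the structure *)

Section HallFacts.
Variables (gT : finGroupType) (pi : nat_pred).
Implicit Types W X C : {group gT}.

(** Turns arithmetic statements on fixed points into containments: W acts trivially
    as soon as no prime of pi divides the index of the fixed points. *)
Lemma pHall_sub_index W X C :
    W <| X -> pi.-Hall(X) W -> C \subset X ->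
  (pi^'.-nat #|X : C|) = (W \subset C).
Proof.
move=> nsWX hallW sCX; apply/idP/idP => [|sWC].
  exact: pi_sub_p'index sCX nsWX (pHall_pgroup hallW).
by case/and3P: hallW => _ _; apply: pnat_dvd; apply: indexgS.
Qed.

Lemma pi_pHall X W q : pi.-Hall(X) W -> q \in \pi(X) -> q \in pi -> q \in \pi(W).
Proof.
by move=> hallW piXq pi_q; rewrite /= (card_Hall hallW) pi_of_part ?cardG_gt0 // inE /= piXq.
Qed.

Lemma pHall_neq1 X W q : pi.-Hall(X) W -> q \in \pi(X) -> q \in pi -> W :!=: 1.
Proof.
move=> hallW piXq pi_q; apply/eqP=> W1.
by have := pi_pHall hallW piXq pi_q; rewrite /= W1 cards1.
Qed.

End HallFacts.

(** Hypotheses on class sizes enter through the products u * y with y in B and u in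
    'C_K[y].  An element u outside 'C(E) has a class size involving delta, so that
    only 1 in B commutes with it; an element y outside 'C(A) has a class size
    involving alpha, and only 1 in K commutes with it.  An edge from r to beta
    provides a nontrivial element of 'C_B(A), which forces E to centralise A, and the
    class of any u outside 'C(E), of size #|B|, shows that beta consists of t and
    delta. *)
Lemma separated_structure (gT : finGroupType) (G : {group gT}) (r t : nat)
    (alpha beta delta : nat_pred) :
    reduced_group G -> prime_partition G r alpha beta -> t \in beta -> r \in \pi(G) ->
    {subset delta <= beta} -> t \notin delta -> (exists q, q \in delta) ->
    beta^'.-group G^`(1) -> class_sep G r alpha -> class_sep G t delta ->
    (exists2 x, x \in G & exists2 q, q \in beta & (r %| #|x ^: G|) && (q %| #|x ^: G|)) ->
  two_cut_vertex_structure G r t alpha beta.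
Proof.
move=> redG part beta_t piGr s_db t'd [d delta_d] beta'G' sepA sepE [x0 Gx0 [q0 beta_q0 /andP[r_x0 q0_x0]]].
have [[a0 alpha_a0] _ disjAB /andP[r'alpha r'beta] piG] := part.
have piGa p : p \in alpha -> p \in \pi(G) by move=> ap; rewrite piG ap orbT.
have piGb p : p \in beta -> p \in \pi(G) by move=> bp; rewrite piG bp !orbT.
have r_pr : prime r by move: piGr; rewrite mem_primes; case/and3P.
have q0_pr : prime q0 by have := piGb _ beta_q0; rewrite mem_primes; case/and3P.
have [B hallB] := der1_p'Hall beta'G'.
have [defG abB] := der1_p'sdprod beta'G' hallB.
have [sBG betaB _] := and3P hallB.
set K := 'O_beta^'(G)%G in defG; have nsKG : K <| G := pcore_normal _ _.
have [sKG nKG] := andP nsKG.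
have beta'K : beta^'.-group K := pcore_pgroup _ _.
have coKB : coprime #|K| #|B| := p'nat_coprime beta'K betaB.
have [_ defKB nKB tiKB] := sdprodP defG.
have hallK : beta^'.-Hall(G) K by apply/(sdprod_normal_pHallP nsKG hallB).
have sab' : {subset alpha <= beta^'}.
  by move=> p ap; apply/negP=> bp; have := disjAB p; rewrite ap bp.
have r'B : [predU1 r & alpha]^'.-group B.
  apply: sub_pgroup betaB => p bp; apply/negP=> /predU1P[pr | ap].
    by rewrite -pr bp in r'beta.
  by have := disjAB p; rewrite ap bp.
have regB := reduced_compl_regular defG abB redG.
pose E := 'O_delta(B)%G.
have hallEB : delta.-Hall(B) E := nilpotent_pcore_Hall _ (abelian_nil abB).
have sEB : E \subset B := pcore_sub _ _.
have nsEB : E <| B := pcore_normal _ _.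
have hallE : delta.-Hall(G) E := subHall_Hall hallB s_db hallEB.
have ntE : E :!=: 1 := pHall_neq1 hallE (piGb _ (s_db _ delta_d)) delta_d.
have delta'G' : delta^'.-group G^`(1).
  by apply: sub_pgroup beta'G' => p; apply: contra; apply: s_db.
have td'K : [predU1 t & delta]^'.-group K.
  by apply: sub_pgroup beta'K => p; apply: contra => /predU1P[-> //|]; apply: s_db.
have abK := separated_kernel_abelian defG abB regB sEB ntE hallE delta'G' td'K sepE.
have regK := reduced_kernel_regular defG abB coKB redG abK.
have classM := compl_class_sizeM defG abB coKB abK.
have GM u y : u \in K -> y \in B -> u * y \in G by move=> Ku By; rewrite -defKB mem_mulg.
pose A := 'O_alpha(K)%G; pose R := 'O_r(K)%G.
have hallAK : alpha.-Hall(K) A := nilpotent_pcore_Hall _ (abelian_nil abK).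
have hallRK : r.-Hall(K) R := nilpotent_pcore_Hall _ (abelian_nil abK).
have nsAK : A <| K := pcore_normal _ _.
have [sAK sRK] : A \subset K /\ R \subset K by rewrite !pcore_sub.
have hallA : alpha.-Hall(G) A := subHall_Hall hallK sab' hallAK.
have hallR : r.-Sylow(G) R.
  by apply: (subHall_Hall hallK) hallRK => p /eqnP->.
have ntA : A :!=: 1 := pHall_neq1 hallA (piGa _ alpha_a0) alpha_a0.
have ntR : R :!=: 1 by apply: (pHall_neq1 hallR piGr); apply: eqxx.
have ntB : B :!=: 1 := pHall_neq1 hallB (piGb _ beta_t) beta_t.
have defAR : A \x R = K.
  rewrite -(nilpotent_pcoreC alpha (abelian_nil abK)); congr (_ \x _).
  apply: eq_in_pcore => p piKp; apply/eqnP/idP => [-> //|a'p].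
  have : p \in \pi(G) by apply: piSg piKp.
  rewrite piG (negPf a'p) => /or3P[/eqP//|//|bp].
  have := pgroupP beta'K p; rewrite mem_primes in piKp; case/and3P: piKp => p_pr _ pK.
  by move/(_ p_pr pK); rewrite inE /= bp.
have [_ defARm cAR tiAR] := dprodP defAR.
have cent_index y : y \in B -> (#|K : 'C_K[y]| == 1)%N -> y = 1.
  move=> By; rewrite indexg_eq1 subsetI subxx /= sub_cent1 => cKy.
  by apply/set1gP; rewrite -regB inE By.
have regE u : u \in K -> u \notin 'C(E) -> 'C_B[u] = 1.
  move=> Ku nEu; apply/trivgP/subsetP=> y /setIP[By /cent1P cyu].
  have cuy : commute u y by apply: commute_sym.
  have [|] := orP (sepE _ (GM u y Ku By)); rewrite classM // pnatM => /andP[pK pB].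
    move: pB; rewrite (pHall_sub_index nsEB hallEB) ?subsetIl // subsetI sEB /=.
    by rewrite sub_cent1 (negPf nEu).
  apply/set1P/(cent_index y By)/eqP/(pnat_1 pK).
  exact: pnat_dvd (dvdn_indexg _ _) td'K.
have regA y : y \in B -> y \notin 'C(A) -> 'C_K[y] = 1.
  move=> By nAy; apply/trivgP/subsetP=> u /setIP[Ku /cent1P cuy].
  have [|] := orP (sepA _ (GM u y Ku By)); rewrite classM // pnatM => /andP[pK pB].
    move: pK; rewrite (pHall_sub_index nsAK hallAK) ?subsetIl // subsetI sAK /=.
    by rewrite sub_cent1 (negPf nAy).
  have: (#|B : 'C_B[u]| == 1)%N.
    by apply/eqP/(pnat_1 pB); apply: pnat_dvd (dvdn_indexg _ _) r'B.
  rewrite indexg_eq1 subsetI subxx /= sub_cent1 => cBu.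
  by rewrite -regK inE Ku.
(* The edge between r and q0 comes from u * y with u and y both nontrivial. *)
have [y0 [By0 cAy0 nty0]] : exists y0, [/\ y0 \in B, y0 \in 'C(A) & y0 != 1].
  have [u [y [Ku By cuy defx0]]] := compl_decomp defG beta'G' hallB Gx0.
  exists y; split=> //.
    apply: contraLR q0_x0 => nAy; move: (regA y By nAy) => CKy.
    have u1 : u = 1 by apply/set1gP; rewrite -CKy inE Ku; apply/cent1P.
    rewrite defx0 classM // u1 cent11T setIT indexgg muln1.
    apply/negP=> q0K; have := pnat_dvd (dvdn_indexg K 'C_K[y]) beta'K.
    by move/pnatP => /(_ (indexg_gt0 _ _) q0 q0_pr q0K); rewrite inE /= beta_q0.
  apply: contraL r_x0 => /eqP y1; rewrite defx0 classM // y1 cent11T setIT indexgg mul1n.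
  apply/negP=> rB; have := pnat_dvd (dvdn_indexg B 'C_B[u]) betaB.
  by move/pnatP => /(_ (indexg_gt0 _ _) r r_pr rB); rewrite (negPf r'beta).
have cAE : A \subset 'C(E).
  apply/subsetP=> a Aa; apply: contraR nty0 => nEa; apply/eqP/set1gP.
  by rewrite -(regE a (subsetP sAK a Aa) nEa) inE By0; apply/cent1P/(centP cAy0).
have regR x : x \in R^# -> 'C_B[x] \subset 'C_B(A).
  case/setD1P=> ntx Rx; apply/subsetP=> y /setIP[By /cent1P cyx]; rewrite inE By.
  apply: contraR ntx => /(regA y By) CKy; apply/eqP/set1gP; rewrite -CKy inE.
  by rewrite (subsetP sRK) //; apply/cent1P.
have regBR : 'C_B(R) = 1.
  have [x Rx ntx] := trivgPn _ ntR.
  apply/trivgP/subsetP=> y /setIP[By cRy]; rewrite -[[1]]regB inE By -defARm centM.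
  rewrite in_setI cRy andbT.
  have R1x : x \in R^# by rewrite !inE ntx.
  have /setIP[] // : y \in 'C_B(A).
  by apply: (subsetP (regR x R1x)); rewrite in_setI By; apply/cent1P/(centP cRy).
have ntKE : ~~ (K \subset 'C(E)).
  by apply: contra ntE => cKE; rewrite -subG1 -regB subsetI sEB centsC.
(* The class of an element u of K outside 'C(E) has size #|B|. *)
have tdB : [predU1 t & delta].-group B.
  have /subsetPn[u Ku nEu] := ntKE.
  have := sepE _ (GM u 1 Ku (group1 B)); rewrite classM //; last exact: commute1.
  rewrite (regE u Ku nEu) indexg1 cent11T setIT indexgg mul1n => /orP[d'B|//].
  case/eqP: ntE; apply/(@card1_trivg _ E)/(@pnat_1 delta); first exact: pcore_pgroup.
  exact: pgroupS sEB d'B.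
have hallEt : t^'.-Hall(B) E.
  rewrite -(eq_in_pHall _ (_ : {in \pi(B), delta =i t^'})) // => p piBp.
  have : p \in [predU1 t & delta] by apply: (allP (andP tdB).2).
  case/predU1P=> [-> | dp]; first by rewrite (negPf t'd) !inE eqxx.
  by rewrite dp !inE; apply/esym; apply: contraNneq t'd => <-.
have nAB : B \subset 'N(A) by rewrite gFnorm_trans.
have nRB : B \subset 'N(R) by rewrite gFnorm_trans.
have abA : abelian A := abelianS sAK abK.
have abR : abelian R := abelianS sRK abK.
have coAB : coprime #|A| #|B| := coprimeSg sAK coKB.
have regAB : 'C_A(B) = 1 by apply/trivgP; rewrite -regK setSI.
pose H := (A <*> B)%G.
have defH : A * B = H by rewrite /= norm_joinEr.
have defZ : 'Z(H) = 'C_B(A) := center_sdprod_cent defH abB abA regAB.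
have sEZ : E \subset 'Z(H) by rewrite defZ subsetI sEB centsC.
have pZB : 'Z(H) \proper B.
  rewrite defZ properE subsetIl subsetI subxx /= centsC.
  by apply: contra ntA => cAB; rewrite -subG1 -regAB subsetI subxx.
have defABR : A * B * R = G by rewrite -mulgA (normC nRB) mulgA defARm.
have oG : #|G| = (#|H| * #|R|)%N.
  rewrite -defH (coprime_cardMg coAB) -defKB (coprime_cardMg coKB) -(dprod_card defAR).
  by rewrite mulnAC.
split=> //; exists A, B, R, H, E; split; last first.
  split=> // b /setD1P[ntb Bb]; apply/trivgP/subsetP=> x /setIP[REx /cent1P cxb].
  have Rx : x \in R.
    by apply: (subsetP _ _ REx); rewrite commg_subl (subset_trans sEB).
  apply: contraR ntb => ntx; apply/eqP/set1gP.
  rewrite -(regE x (subsetP sRK x Rx)); first by rewrite inE Bb; apply/cent1P.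
  apply: contra ntx => cEx.
  rewrite -(@coprime_abel_cent_TI _ E R) ?(subset_trans sEB) //; last first.
    by apply: coprimeSg sRK _; apply: coprimegS sEB coKB.
  by rewrite inE REx.
split=> //.
  split=> //; rewrite /pHall -divgS; last by rewrite -defABR defH mulG_subl.
  rewrite oG mulKn ?cardG_gt0 // pnatNK (pHall_pgroup hallR : r.-nat _) andbT.
  rewrite -{1}defABR defH mulG_subl /= -defH /pgroup (coprime_cardMg coAB) pnatM.
  apply/andP; split; [move: (pHall_pgroup hallA) | move: betaB].
    by apply: sub_pgroup => p ap; apply: contra r'alpha => /eqP <-.
  by apply: sub_pgroup => p bp; apply: contra r'beta => /eqP <-.
split=> //.
- by rewrite defAR (Fitting_abelian_kernel defG).
- split=> //; rewrite defZ; apply/trivgPn; exists y0 => //.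
  by rewrite inE By0.
- apply: (Frobenius_quotient_center defH) => // b Bb nZb; apply/trivgP.
  rewrite defZ inE Bb /= in nZb; rewrite -(regA b Bb nZb) setSI //.
by split=> // x /regR; rewrite defZ.
Qed.

(** * Cut vertices of finite graphs *)

Section CutVertex.
Variables (T : finType) (e : rel T).
Hypothesis sym_e : symmetric e.
Implicit Types (S : {set T}) (v w x y : T).

Lemma induced_connect_sym S : connect_sym (induced_rel e S).
Proof.
by apply: sym_connect_sym => x y; rewrite /induced_rel /= sym_e andbCA.
Qed.

Lemma connect_closed_mem (r : rel T) (P : pred T) x y :
  (forall z w, P z -> r z w -> P w) -> P x -> connect r x y -> P y.
Proof.
move=> closedP Px /connectP[p]; elim: p x Px => [|z p IHp] x Px /= => [_ -> //|].
by case/andP=> /(closedP x z Px)/IHp.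
Qed.

Lemma components_eq S x y : y \in S -> connect (induced_rel e S) x y ->
  [set z in S | connect (induced_rel e S) x z] = [set z in S | connect (induced_rel e S) y z].
Proof.
move=> Sy cxy; apply/setP=> z; rewrite !inE.
by rewrite (same_connect (@induced_connect_sym S) cxy).
Qed.

(** If all the neighbours of v were joined without using v, then deleting v would
    not disconnect any two other vertices, and the map from the components without
    v to those with v would be injective. *)
Lemma cut_vertex_neighbours S v : cut_vertex e S v ->
  exists a b, [/\ a \in S :\ v, b \in S :\ v, e v a, e v b
                & ~~ connect (induced_rel e (S :\ v)) a b].
Proof.
case=> Sv; rewrite ltnNge => /negP ltC.
case: (boolP [exists a, exists b, [&& a \in S :\ v, b \in S :\ v, e v a, e v b
                & ~~ connect (induced_rel e (S :\ v)) a b]]).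
  by case/existsP=> a /existsP[b /and5P[*]]; exists a, b.
move=> nab; case: ltC.
have joined a b : a \in S :\ v -> b \in S :\ v -> e v a -> e v b ->
    connect (induced_rel e (S :\ v)) a b.
  move=> Sa Sb va vb; apply: contraR nab => nab.
  by apply/existsP; exists a; apply/existsP; exists b; apply/and5P.
have conn x y : x \in S :\ v -> y \in S :\ v -> connect (induced_rel e S) x y ->
    connect (induced_rel e (S :\ v)) x y.
  move=> Sx Sy cxy.
  (* P z: z is reached from x in S :\ v or, for z = v, some neighbour of v is. *)
  pose P z := if z == v then [exists a, [&& a \in S :\ v, e v a & connect (induced_rel e (S :\ v)) x a]]
              else connect (induced_rel e (S :\ v)) x z.
  suffices: P y by rewrite /P; case/setD1P: Sy => /negPf->.
  apply: connect_closed_mem cxy => [z w|]; last by rewrite /P; case/setD1P: Sx => /negPf->.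
  rewrite /P => Pz /and3P[Sz Sw ezw].
  move: Pz; have [eq_wv | nwv] := eqVneq w v; have [eq_zv | nzv] := eqVneq z v => // Pz.
  - have evz : e v z by rewrite sym_e -eq_wv.
    by apply/existsP; exists z; rewrite !inE nzv Sz evz.
  - case/existsP: Pz => a /and3P[Sa va cxa].
    by apply: connect_trans cxa (joined a w _ _ _ _); rewrite // ?inE ?nwv // -eq_zv.
  apply: connect_trans Pz (connect1 _).
  by rewrite /induced_rel /= !inE nzv nwv Sz Sw.
pose cl S x := [set y in S | connect (induced_rel e S) x y].
(* g recovers a component of S :\ v from the component of S containing it. *)
pose g (C : {set T}) := cl (S :\ v) (odflt v [pick x in C :&: (S :\ v)]).
have /subset_leq_card : components e (S :\ v) \subset g @: components e S.
  apply/subsetP=> _ /imsetP[x Sx ->]; have Sx1 := subsetP (subD1set S v) x Sx.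
  apply/imsetP; exists (cl S x); first exact: imset_f.
  rewrite /g; case: pickP => [y | /(_ x)]; last by rewrite !in_setI Sx !inE Sx1 connect0.
  rewrite inE => /andP[]; rewrite inE => /andP[Sy1 cxy] Sy.
  by apply: components_eq => //; apply: conn.
by move/leq_trans; apply; apply: leq_imset_card.
Qed.

(** Two neighbours of v lie in different components of S :\ v, and at most one of
    these components contains w. *)
Lemma cut_vertex_component S v w : w != v -> w \in S -> cut_vertex e S v ->
  exists C : {set T},
    [/\ C \subset S :\ v, w \notin C,
        exists2 a, a \in C & e v a /\ {in C, forall x, connect (induced_rel e C) a x},
        exists2 b, b \in (S :\ v) :\: C & e v b
      & {in C & S :\ v, forall x y, e x y -> y \in C}].
Proof.
move=> nwv Sw /cut_vertex_neighbours[a1 [b1 [Sa1 Sb1 va1 vb1 nab1]]].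
set r := induced_rel e (S :\ v) in nab1.
have [a [b [[Sa Sb va vb nab] nwa]]] : exists a b,
    [/\ a \in S :\ v, b \in S :\ v, e v a, e v b & ~~ connect r a b] /\ ~~ connect r a w.
  case: (boolP (connect r a1 w)) => [ca1w | na1w]; last by exists a1, b1.
  exists b1, a1; split; first by split=> //; rewrite induced_connect_sym.
  by apply: contra nab1; rewrite induced_connect_sym => /(connect_trans ca1w); rewrite induced_connect_sym.
pose C := [set x in S :\ v | connect r a x].
have closedC : {in C & S :\ v, forall x y, e x y -> y \in C}.
  move=> x y; rewrite inE => /andP[Sx cax] Sy exy; rewrite inE Sy.
  by apply: connect_trans cax (connect1 _); rewrite /r /induced_rel /= Sx Sy.
have Ca : a \in C by rewrite inE Sa connect0.
exists C; split=> //.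
- by apply/subsetP=> x; rewrite inE => /andP[].
- by rewrite inE (negPf nwa) andbF.
- exists a => //; split=> // x; rewrite inE => /andP[_ cax].
  pose P y := (y \in C) && connect (induced_rel e C) a y.
  suffices /andP[] : P x by [].
  apply: connect_closed_mem cax => [y z /andP[Cy cay] /and3P[Sy Sz eyz]|].
    have Cz := closedC y z Cy Sz eyz; rewrite /P Cz.
    by apply: connect_trans cay (connect1 _); rewrite /induced_rel /= Cy Cz.
  by rewrite /P Ca connect0.
by exists b => //; rewrite inE Sb andbT inE (negPf nab) andbF.
Qed.

(** S is connected, while S :\ v has at least the components of a and b. *)
Lemma cut_vertex_separated S v a b : v \in S ->
    {in S, forall x, connect (induced_rel e S) v x} ->
    a \in S :\ v -> b \in S :\ v -> ~~ connect (induced_rel e (S :\ v)) a b ->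
  cut_vertex e S v.
Proof.
move=> Sv conn Sa Sb nab; split=> //.
pose cl S x := [set y in S | connect (induced_rel e S) x y].
apply: (@leq_ltn_trans 1).
  rewrite -(cards1 (cl S v)); apply: subset_leq_card.
  apply/subsetP=> _ /imsetP[x Sx ->]; rewrite inE; apply/eqP/esym.
  by apply: components_eq => //; apply: conn.
rewrite (leq_trans (_ : 1 < #|[set cl (S :\ v) a; cl (S :\ v) b]|)) //.
  rewrite cards2 ltnS lt0b; apply: contra nab => /eqP/setP/(_ b).
  by rewrite [LHS]in_set [RHS]in_set Sb connect0.
by apply: subset_leq_card; apply/subsetP=> C /set2P[] ->; apply: imset_f.
Qed.

End CutVertex.

(** * The class size graph *)

Section ClassGraph.
Variables (gT : finGroupType) (G : {group gT}).
Local Notation vertex := 'I_#|G|.+1.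

Lemma cs_adj_sym : symmetric (@cs_adj _ G).
Proof.
move=> p q; rewrite /cs_adj /= andbCA eq_sym; congr [&& _, _, _ & _].
by rewrite mulnC.
Qed.

Lemma cs_adjP (p q : vertex) : prime p -> prime q -> p != q ->
  reflect (exists2 x, x \in G & (p %| #|x ^: G|) && (q %| #|x ^: G|)) (cs_adj p q).
Proof.
move=> p_pr q_pr npq; have co_pq : coprime p q by rewrite prime_coprime // dvdn_prime2.
apply: (iffP and4P) => [[_ _ _ /exists_inP[_ /imsetP[x Gx ->]]] | [x Gx /andP[px qx]]].
  by rewrite Gauss_dvd // => pqx; exists x.
have exC (m : nat) : m %| #|x ^: G| -> [exists C in classes G, m %| #|C|].
  by move=> mx; apply/exists_inP; exists (x ^: G); rewrite ?mem_classes.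
by rewrite !inE p_pr q_pr !exC ?Gauss_dvd ?px.
Qed.

Hypothesis redG : reduced_group G.

Lemma cs_verticesE (p : vertex) : (p \in cs_vertices G) = (val p \in \pi(G)).
Proof.
rewrite inE; apply/andP/idP => [[p_pr /exists_inP[_ /imsetP[x Gx ->] px]] | piGp].
  by rewrite mem_primes p_pr cardG_gt0 (dvdn_trans px) // -index_cent1 dvdn_indexg.
have [x Gx px] := reduced_vertex redG piGp.
split; first by move: piGp; rewrite mem_primes => /and3P[].
by apply/exists_inP; exists (x ^: G); rewrite ?mem_classes.
Qed.

Lemma pi_vertex (p : nat) : p \in \pi(G) -> exists v : vertex, val v = p.
Proof.
rewrite mem_primes => /and3P[_ _ pG].
have lt_p : p < #|G|.+1 by rewrite ltnS dvdn_leq.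
by exists (Ordinal lt_p).
Qed.

Definition vertex_pred (C : {set vertex}) : nat_pred :=
  [pred p | [exists v in C, val v == p]].

Lemma vertex_predE C (v : vertex) : (val v \in vertex_pred C) = (v \in C).
Proof.
apply/exists_inP/idP => [[w Cw /eqP/val_inj <-] // | Cv]; by exists v.
Qed.

Definition separated (s w : nat) (pi : nat_pred) : Prop :=
  [/\ {subset pi <= \pi(G)}, exists p, p \in pi, s \notin pi, w \notin pi & class_sep G s pi].

Lemma pi_class x p : x \in G -> prime p -> p %| #|x ^: G| -> p \in \pi(G).
Proof.
move=> Gx p_pr px; rewrite mem_primes p_pr cardG_gt0 (dvdn_trans px) //.
by rewrite -index_cent1 dvdn_indexg.
Qed.

(** Besides the separated set of primes, this keeps what is needed later: C is
    connected, which makes the sets attached to two cut vertices disjoint, and v has a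
    neighbour outside C. *)
Lemma cut_vertex_data (v w : vertex) : w != v -> w \in cs_vertices G ->
    cut_vertex (@cs_adj _ G) (cs_vertices G) v ->
  exists C : {set vertex},
    [/\ C \subset cs_vertices G :\ v, w \notin C,
        exists2 a, a \in C & cs_adj v a /\ {in C, forall x, connect (induced_rel (@cs_adj _ G) C) a x},
        {in C & cs_vertices G :\ v, forall x y, cs_adj x y -> y \in C}
     &  separated v w (vertex_pred C) /\
        exists2 x, x \in G & exists2 q, (q \in \pi(G)) && (q \notin [predU1 val v & vertex_pred C]) &
            (v %| #|x ^: G|) && (q %| #|x ^: G|)].
Proof.
move=> nwv Vw cut_v; have Vv := proj1 cut_v.
have primeV (p : vertex) : p \in cs_vertices G -> prime p by rewrite inE => /andP[].
have [C [sCV nCw exa [b /setDP[Vb nCb] vb] closedC]] := cut_vertex_component cs_adj_sym nwv Vw cut_v.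
have sCV1 x : x \in C -> x != v /\ x \in cs_vertices G by move/(subsetP sCV)/setD1P.
exists C; split=> //; split.
  split.
  - by move=> _ /exists_inP[p Cp /eqP <-]; rewrite -cs_verticesE; case: (sCV1 p Cp).
  - by case: exa => a Ca _; exists (val a); rewrite vertex_predE.
  - by rewrite vertex_predE; apply/negP=> /sCV1[]; rewrite eqxx.
  - by rewrite vertex_predE.
  move=> x Gx; have x_gt0 : 0 < #|x ^: G| by rewrite -index_cent1 indexg_gt0.
  have [//|/=] := boolP (_^'.-nat _); rewrite /pnat x_gt0 => /allPn[p].
  rewrite mem_primes => /and3P[p_pr _ px] /negPn/exists_inP[p1 Cp1 /eqP defp].
  apply/allP=> q; rewrite mem_primes => /and3P[q_pr _ qx].
  have [q1 defq] := pi_vertex (pi_class Gx q_pr qx).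
  rewrite -defq inE /=; apply/predU1P.
  have [-> | nqv] := eqVneq q1 v; [by left | right]; rewrite vertex_predE.
  have [<- // | npq] := eqVneq p1 q1.
  apply: closedC (Cp1) _ _; first by rewrite in_setD1 nqv cs_verticesE defq (pi_class Gx).
  by apply/cs_adjP; rewrite ?defp ?defq //; exists x; rewrite ?px.
have [nbv Vb1] := setD1P Vb.
have [x Gx vbx] : exists2 x, x \in G & (v %| #|x ^: G|) && (b %| #|x ^: G|).
  by apply/(cs_adjP (primeV _ Vv) (primeV _ Vb1)); rewrite // eq_sym.
exists x => //; exists (val b) => //.
rewrite -cs_verticesE Vb1; apply/negP=> /predU1P[/val_inj eq_bv | ].
  by rewrite eq_bv eqxx in nbv.
by rewrite vertex_predE (negPf nCb).
Qed.
End ClassGraph.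

(** * Two cut vertices force the structure *)

Section Forward.
Variables (gT : finGroupType) (G : {group gT}).
Hypothesis redG : reduced_group G.

Definition burnside_prime (p : nat) : bool :=
  [forall P : {group gT}, p.-Sylow(G) P ==> ('N_G(P) \subset 'C(P))].

Lemma burnside_der1 (pi : nat_pred) :
  {in \pi(G), forall p, p \in pi -> burnside_prime p} -> pi^'.-group G^`(1).
Proof.
move=> goodG; apply/pgroupP=> p p_pr pG'; apply/negP=> pi_p.
have piGp : p \in \pi(G).
  by rewrite mem_primes p_pr cardG_gt0 (dvdn_trans pG') ?cardSg ?der_sub.
have [P sylP] := Sylow_exists p G.
have sNC := implyP (forallP (goodG p piGp pi_p) P) sylP.
have := der1_p'group sylP sNC; rewrite /pgroup p'natE // => /negP; exact.
Qed.

Lemma burnside_separated s (pi : nat_pred) p q : class_sep G s pi ->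
    prime p -> prime q -> p \in pi -> q \notin [predU1 s & pi] ->
  burnside_prime p || burnside_prime q.
Proof.
move=> sep p_pr q_pr pi_p pi'q; apply/norP => -[/forallPn[P] /[!negb_imply]/andP[sylP nP]].
move=> /forallPn[Q] /[!negb_imply]/andP[sylQ nQ].
have := Sylow_cent_or p_pr q_pr sylP sylQ; rewrite (negPf nP) (negPf nQ) /=.
move=> /(_ _)/negP[] // x Gx; have x_gt0 : 0 < #|x ^: G| by rewrite -index_cent1 indexg_gt0.
case/orP: (sep x Gx) => /(pnatP _ x_gt0) pin; apply/orP; [left | right]; apply/negP.
  by move/(pin p p_pr); rewrite inE /= pi_p.
by move/(pin q q_pr); apply/negP.
Qed.

(** A prime of alpha violating Burnside's hypothesis makes all the primes that are
    neither r nor in alpha satisfy it. *)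
Lemma separated_side_structure (r t : nat) (alpha delta : nat_pred) p :
    prime r -> prime t -> r != t -> r \in \pi(G) -> t \in \pi(G) ->
    separated G r t alpha -> separated G t r delta ->
    (forall p, ~~ ((p \in alpha) && (p \in delta))) ->
    (exists2 x, x \in G & exists2 q, (q \in \pi(G)) && (q \notin [predU1 r & alpha]) &
        (r %| #|x ^: G|) && (q %| #|x ^: G|)) ->
    p \in alpha -> ~~ burnside_prime p ->
  exists beta, two_cut_vertex_structure G r t alpha beta.
Proof.
move=> r_pr t_pr nrt piGr piGt [sa [a alpha_a] nra nta sepA] [sd exd ntd nrd sepD] dis adj alpha_p bad_p.
pose beta : nat_pred := [pred q | (q \in \pi(G)) && (q \notin [predU1 r & alpha])].
have primeG q : q \in \pi(G) -> prime q by rewrite mem_primes => /and3P[].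
exists beta; apply: (separated_structure redG _ _ piGr (delta := delta)) => //.
- split=> //; first by exists a.
  + by exists t; rewrite !inE piGt eq_sym (negPf nrt) (negPf nta).
  + by move=> q; rewrite !inE; case: (q \in alpha); rewrite ?orbT ?andbF.
  + by rewrite nra !inE eqxx andbF.
  move=> q; rewrite !inE; case: (eqVneq q r) => [->|_]; first by rewrite piGr.
  by case: (boolP (q \in alpha)) => [/sa-> //|_]; rewrite andbT.
- by rewrite !inE piGt eq_sym (negPf nrt) (negPf nta).
- move=> q dq; rewrite !inE sd //; apply/norP; split; last by have := dis q; rewrite dq andbT.
  by apply: contraNneq nrd => <-.
apply: burnside_der1 => q piGq /andP[_ nq].
have := burnside_separated sepA (primeG _ (sa _ alpha_p)) (primeG _ piGq) alpha_p nq.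
by rewrite (negPf bad_p).
Qed.

Lemma separated_not_both_burnside (r t : nat) (alpha delta : nat_pred) :
    separated G r t alpha -> separated G t r delta ->
    (forall p, ~~ ((p \in alpha) && (p \in delta))) ->
    {in alpha, forall p, burnside_prime p} -> {in delta, forall p, burnside_prime p} ->
  False.
Proof.
move=> [sa [a alpha_a] nra nta sepA] [sd [d delta_d] ntd nrd sepD] dis goodA goodD.
pose sigma : nat_pred := [predU alpha & delta].
have sigma'G' : sigma^'.-group G^`(1).
  by apply: burnside_der1 => p _ /orP[/goodA | /goodD].
have [D hallD] := der1_p'Hall sigma'G'.
have [defG abD] := der1_p'sdprod sigma'G' hallD.
have sigmaD := pHall_pgroup hallD.
set K := 'O_sigma^'(G)%G in defG; have sigma'K : sigma^'.-group K := pcore_pgroup _ _.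
have coKD : coprime #|K| #|D| := p'nat_coprime sigma'K sigmaD.
have regD := reduced_compl_regular defG abD redG.
have salpha : {subset alpha <= sigma} by move=> p ap; apply/orP; left.
have sdelta : {subset delta <= sigma} by move=> p dp; apply/orP; right.
have sub' (pi : nat_pred) (H : {group gT}) : {subset pi <= sigma} -> sigma^'.-group H -> pi^'.-group H.
  by move=> spi; apply: sub_pgroup => p; apply: contra; apply: spi.
have hallA := subHall_Hall hallD salpha (nilpotent_pcore_Hall alpha (abelian_nil abD)).
have hallE := subHall_Hall hallD sdelta (nilpotent_pcore_Hall delta (abelian_nil abD)).
have ntA := pHall_neq1 hallA (sa _ alpha_a) alpha_a.
have ntE := pHall_neq1 hallE (sd _ delta_d) delta_d.
have tiAD p : p \in alpha -> p \notin [predU1 t & delta].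
  move=> ap; rewrite !inE negb_or; apply/andP; split; last by have := dis p; rewrite ap.
  by apply: contraNneq nta => <-.
have tiDA p : p \in delta -> p \notin [predU1 r & alpha].
  move=> dp; rewrite !inE negb_or; apply/andP; split; last by have := dis p; rewrite dp andbT.
  by apply: contraNneq nrd => <-.
exact: (no_two_separated_Hall defG abD coKD regD (pcore_sub _ _) hallA ntA
          (pcore_sub _ _) hallE ntE (sub' _ _ salpha sigma'G') (sub' _ _ sdelta sigma'G')
          (sub' _ _ salpha sigma'K) (sub' _ _ sdelta sigma'K) tiAD tiDA sepA sepD).
Qed.

Lemma cut_vertices_structure (r t : nat) : prime r -> prime t -> r <> t ->
    cs_cut_vertex G r -> cs_cut_vertex G t ->
  exists alpha beta : nat_pred,
     two_cut_vertex_structure G r t alpha beta \/ two_cut_vertex_structure G t r alpha beta.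
Proof.
move=> r_pr t_pr nrt [v def_v cutv] [w def_w cutw].
have Vv := proj1 cutv; have Vw := proj1 cutw.
have nwv : w != v by apply/eqP=> wv; apply: nrt; rewrite -def_v -wv def_w.
have nvw : v != w by rewrite eq_sym.
have [C [sCV nCw [a Ca [va connC]] closedC [sepC adjC]]] := cut_vertex_data redG nwv Vw cutv.
have [D [sDV nDv [d Dd [wd connD]] closedD [sepD adjD]]] := cut_vertex_data redG nvw Vv cutw.
have sCw x : x \in C -> x \in cs_vertices G :\ w.
  move=> Cx; rewrite in_setD1; have /setD1P[_ ->] := subsetP sCV x Cx.
  by rewrite andbT; apply: contraNneq nCw => <-.
(* A common vertex would put the connected set C, hence also v, inside D. *)
have disCD x : x \in C -> x \in D -> False.
  move=> Cx Dx; case/negP: nDv; apply: (closedD a); rewrite ?(@cs_adj_sym _ G a) //.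
    pose P z := (z \in C) && (z \in D).
    suffices /andP[] : P a by [].
    have := connC x Cx; rewrite (induced_connect_sym (@cs_adj_sym _ G)).
    apply: connect_closed_mem => [y z /andP[Cy Dy] /and3P[_ Cz yz]|]; last by rewrite /P Cx.
    by rewrite /P Cz; apply: closedD yz => //; apply: sCw.
  by rewrite in_setD1 nvw Vv.
pose alpha := vertex_pred C; pose delta := vertex_pred D.
have dis p : ~~ ((p \in alpha) && (p \in delta)).
  apply/andP => -[/exists_inP[x Cx /eqP <-]]; rewrite vertex_predE; exact: disCD.
have [piGr piGt] : r \in \pi(G) /\ t \in \pi(G).
  by rewrite -def_v -def_w -!(cs_verticesE redG).
have def_v' : v = r :> nat := def_v; have def_w' : w = t :> nat := def_w.
rewrite ?def_v ?def_w ?def_v' ?def_w' in sepC sepD adjC adjD.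
have nrt' : r != t by apply/eqP.
case: (boolP [forall x in C, burnside_prime (val x)]) => [goodC | /forall_inPn[x Cx badx]].
  case: (boolP [forall x in D, burnside_prime (val x)]) => [goodD | /forall_inPn[x Dx badx]].
    case: (separated_not_both_burnside sepC sepD dis) => p /exists_inP[x xP /eqP <-].
      exact: (forall_inP goodC).
    exact: (forall_inP goodD).
  have dis' p : ~~ ((p \in delta) && (p \in alpha)) by rewrite andbC.
  have Dx' : val x \in delta by rewrite vertex_predE.
  have ntr' : t != r by rewrite eq_sym.
  have [beta ?] := separated_side_structure t_pr r_pr ntr' piGt piGr sepD sepC dis' adjD Dx' badx.
  by exists delta, beta; right.
have Cx' : val x \in alpha by rewrite vertex_predE.
have [beta ?] := separated_side_structure r_pr t_pr nrt' piGr piGt sepC sepD dis adjC Cx' badx.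
by exists alpha, beta; left.
Qed.

End Forward.

(** * Class sizes of a group with the structure *)

(** In a Frobenius group the centraliser of a nontrivial element of the kernel lies
    in the kernel; here A / Z and B / Z have coprime orders. *)
Lemma Frobenius_quotient_regular (gT : finGroupType) (A B H Z : {group gT}) a b :
    A * B = H -> B \subset 'N(A) -> coprime #|A| #|B| ->
    Z \subset B -> H \subset 'N(Z) ->
    [Frobenius H / Z with kernel (A * Z) / Z] ->
  a \in A^# -> b \in B -> commute a b -> b \in Z.
Proof.
move=> defH nAB coAB sZB nZH; rewrite quotientMidr => /existsP[L frobH].
have sAH : A \subset H by rewrite -defH mulG_subl.
have sBH : B \subset H by rewrite -defH mulG_subr.
case/setD1P=> nta Aa Bb cab.
have nZa := subsetP nZH a (subsetP sAH a Aa).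
have nZb := subsetP nZH b (subsetP sBH b Bb).
have ntaQ : coset Z a \in (A / Z)^#.
  rewrite !inE mem_quotient // andbT; apply: contra nta => /eqP/(coset_idr nZa) Za.
  by apply/eqP/set1gP; rewrite -(coprime_TIg coAB) inE Aa (subsetP sZB).
have := subsetP (Frobenius_cent1_ker (K := (A / Z)%G) frobH ntaQ) (coset Z b).
rewrite inE mem_quotient ?(subsetP sBH) //= => AQb.
have {}AQb : coset Z b \in A / Z.
  by apply: AQb; apply/cent1P; rewrite /commute -!morphM // cab.
apply: coset_idr nZb _; apply/set1gP.
rewrite -(coprime_TIg (coprime_morph (coset Z) coAB)) inE; apply/andP; split=> //.
exact: mem_quotient.
Qed.

Section StructureClassSizes.
Variables (gT : finGroupType) (G A B R H Bs : {group gT}).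
Variables (r t : nat) (alpha beta : nat_pred).
Hypotheses (r_pr : prime r) (t_pr : prime t).
Hypothesis part : prime_partition G r alpha beta.
Hypothesis condA : condition_a G r t alpha beta A B R H.

Let K := 'F(G)%G.

Lemma structure_sdprod : [/\ K ><| B = G, abelian K & beta^'.-group K].
Proof.
have [_ _ disjAB /andP[r'alpha r'beta] piG] := part.
have [beta_t [defABR hallA hallB hallR] [ntA ntB ntR] [defH hallH]] := condA.
move=> [[abA abB abR] defAR [pZB ntZ] frobHZ [regBR regR]].
have [sAG alphaA _] := and3P hallA; have [sBG betaB _] := and3P hallB.
have [sRG rR _] := and3P hallR.
have defK : A \x R = K := defAR.
have [_ defKm cAR tiAR] := dprodP defK.
have abK : abelian K by rewrite -defKm abelianM abA abR.
have beta'K : beta^'.-group K.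
  rewrite /pgroup -(dprod_card defK) pnatM; apply/andP; split.
    apply: sub_pgroup alphaA => p ap; apply/negP=> bp.
    by have := disjAB p; rewrite ap bp.
  by apply: sub_pgroup rR => p /eqnP->.
have nKB : B \subset 'N(K) by rewrite (subset_trans sBG) ?gFnorm.
split=> //; rewrite sdprodE ?(coprime_TIg (p'nat_coprime beta'K betaB)) //.
apply/eqP; rewrite eqEsubset mul_subG ?gFsub //= -norm_joinEr // -defABR.
have [sAK sRK] : A \subset K /\ R \subset K by rewrite -defKm mulG_subl mulG_subr.
rewrite !mul_subG ?joing_subr //.
  exact: subset_trans sAK (joing_subl _ _).
exact: subset_trans sRK (joing_subl _ _).
Qed.

Hypothesis condB : condition_b t B R H Bs.

(** An element y of B outside 'Z(H) centralises only 1 in 'F(G), and its class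
    joins all the primes of alpha and r.  A nontrivial element of [~: R, Bs] commutes
    only with 1 in B, and its class joins all the primes of beta.  Finally, if a
    and y are nontrivial in A and 'Z(H), then n(a * y) involves r and t, as 'Z(H)
    contains the Hall t'-subgroup Bs of B.  For the missing edges, n(u * y) involves
    alpha only if y is outside 'Z(H), whence u = 1, and it involves r only if y is
    nontrivial, whence Bs commutes with u and n(u * y) is prime to beta - t. *)
Lemma structure_class_sizes :
  [/\ t \in beta /\ (exists2 q, q \in beta & q != t),
      exists2 x, x \in G & {in [predU1 r & alpha], forall p, p %| #|x ^: G|},
      (exists2 x, x \in G & {in beta, forall p, p %| #|x ^: G|}) /\
      (exists2 x, x \in G & (r %| #|x ^: G|) && (t %| #|x ^: G|)),
      forall x p q, x \in G -> p \in alpha -> q \in beta ->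
        p %| #|x ^: G| -> q %| #|x ^: G| -> False
    & forall x q, x \in G -> q \in beta -> q != t ->
        r %| #|x ^: G| -> q %| #|x ^: G| -> False].
Proof.
have [defG abK beta'K] := structure_sdprod.
have [_ _ disjAB /andP[r'alpha r'beta] piG] := part.
have [beta_t [_ hallA hallB hallR] [ntA ntB ntR] [defH hallH]] := condA.
move=> [[abA abB abR] defAR [pZB ntZ] frobHZ [regBR regR]].
have [hallBs ntBs sBsZ regBs] := condB.
have [sAG alphaA _] := and3P hallA; have [sBG betaB _] := and3P hallB.
have [sRG rR _] := and3P hallR; have [sBsB t'Bs _] := and3P hallBs.
have sZB := proper_sub pZB.
have piGa p : p \in alpha -> p \in \pi(G) by move=> ap; rewrite piG ap orbT.
have piGb p : p \in beta -> p \in \pi(G) by move=> bp; rewrite piG bp !orbT.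
have piGr : r \in \pi(G) by rewrite piG eqxx.
have primeG q : q \in \pi(G) -> prime q by rewrite mem_primes => /and3P[].
have nsKG : K <| G := Fitting_normal G.
have defK : A \x R = K := defAR.
have [_ defKm cAR tiAR] := dprodP defK.
have [sAK sRK] : A \subset K /\ R \subset K by rewrite -defKm mulG_subl mulG_subr.
have nKB : B \subset 'N(K) := subset_trans sBG (normal_norm nsKG).
have coKB : coprime #|K| #|B| := p'nat_coprime beta'K betaB.
have coAB : coprime #|A| #|B| := coprimeSg sAK coKB.
have defKB : K * B = G by have [_ ? _ _] := sdprodP defG.
have beta'G' : beta^'.-group G^`(1).
  apply: pgroupS beta'K; apply: der1_min; first exact: normal_norm.
  by rewrite -(isog_abelian (sdprod_isog defG)).
have classM := compl_class_sizeM defG abB coKB abK.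
have GM u y : u \in K -> y \in B -> u * y \in G by move=> Ku By; rewrite -defKB mem_mulg.
have hallAK : alpha.-Hall(K) A := pHall_subl sAK (normal_sub nsKG) hallA.
have hallRK : r.-Hall(K) R := pHall_subl sRK (normal_sub nsKG) hallR.
have nsAK : A <| K by rewrite -sub_abelian_normal.
have nsRK : R <| K by rewrite -sub_abelian_normal.
have nAB : B \subset 'N(A).
  have <- : 'O_alpha(K) = A by apply: normal_Hall_pcore hallAK nsAK.
  by rewrite gFnorm_trans.
have nRB : B \subset 'N(R).
  have <- : 'O_r(K) = R by apply: normal_Hall_pcore hallRK nsRK.
  by rewrite gFnorm_trans.
have decomp u : u \in K -> exists a x, [/\ a \in A, x \in R, u = a * x,
    forall y, commute u y -> commute a y & forall y, commute u y -> commute x y].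
  move=> Ku; exists u.`_alpha, u.`_alpha^'.
  have Ka : u.`_alpha \in K by rewrite groupX.
  have Kx : u.`_alpha^' \in K by rewrite groupX.
  have hallR' : alpha^'.-Hall(K) R.
    by apply/(sdprod_normal_pHallP nsRK hallAK)/dprodWsdC.
  have commC pi y : commute u y -> commute u.`_pi y.
    by move/commute_sym=> cyu; apply: commute_sym; apply: commuteX.
  split=> [|||y|y]; rewrite ?consttC //; try exact: commC.
    by rewrite (mem_normal_Hall hallAK nsAK) ?p_elt_constt.
  by rewrite (mem_normal_Hall hallR' nsRK) ?p_elt_constt.
have sAH : A \subset H by rewrite -defH mulG_subl.
have cZA : 'Z(H) \subset 'C(A) by rewrite (subset_trans (subsetIr _ _)) ?centS.
have regA a y : a \in A^# -> y \in B -> commute a y -> y \in 'Z(H).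
  by apply: (Frobenius_quotient_regular defH nAB coAB sZB _ frobHZ); rewrite gFnorm.
have regK y : y \in B -> y \notin 'Z(H) -> 'C_K[y] = 1.
  move=> By nZy; apply/trivgP/subsetP=> u /setIP[Ku /cent1P cuy].
  have [a [x [Aa Rx defu cua cux]]] := decomp u Ku; rewrite defu.
  have [-> | nta] := eqVneq a 1; last first.
    by case/negP: nZy; apply: (regA a); [rewrite !inE nta | | apply: cua].
  have [-> | ntx] := eqVneq x 1; first by rewrite mulg1.
  have R1x : x \in R^# by rewrite !inE ntx.
  case/negP: nZy; apply: (subsetP (regR x R1x)).
  by rewrite in_setI By; apply/cent1P/commute_sym/cux.
have regB u : u \in [~: R, Bs]^# -> 'C_B[u] = 1.
  case/setD1P=> ntu RBu; apply/trivgP/subsetP=> y /setIP[By /cent1P cyu].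
  have [-> | nty] := eqVneq y 1; first exact: set11.
  have By1 : y \in B^# by rewrite !inE nty.
  case/eqP: ntu; apply/set1gP; rewrite -(regBs y By1) inE RBu.
  exact/cent1P/commute_sym.
have sRBR : [~: R, Bs] \subset R by rewrite commg_subl (subset_trans sBsB).
have [b0 Bb0 nZb0] : exists2 b, b \in B & b \notin 'Z(H).
  by apply/subsetPn; rewrite proper_subn.
have t_dvd m : m %| #|B : Bs| -> (m != 1)%N -> t %| m.
  have [_ _] := and3P hallBs; rewrite pnatNK => tB mB nm1.
  have tm : t.-nat m := pnat_dvd mB tB.
  apply: contraR nm1 => t'm; apply/eqP/(pnat_1 tm).
  by rewrite p'natE.
have classE x : x \in G -> exists u y, [/\ u \in K, y \in B, commute u y
    & #|x ^: G| = (#|K : 'C_K[y]| * #|B : 'C_B[u]|)%N].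
  move=> Gx; have [u [y [Ku By cuy defx]]] := compl_decomp defG beta'G' hallB Gx.
  by exists u, y; split; rewrite // defx classM.
have beta_index q (C : {group gT}) : q \in beta -> ~~ (q %| #|K : C|).
  move=> bq; apply/negP=> qK; have q_pr := primeG q (piGb q bq).
  have := pgroupP beta'K q q_pr (dvdn_trans qK (dvdn_indexg _ _)).
  by rewrite inE /= bq.
have beta'_index p (C : {group gT}) : prime p -> p \notin beta -> ~~ (p %| #|B : C|).
  move=> p_pr b'p; apply: contra b'p => pB.
  exact: pgroupP betaB p p_pr (dvdn_trans pB (dvdn_indexg _ _)).
split.
- split=> //.
  have [|q q_pr qBs] := @pdivP #|Bs|; first by rewrite cardG_gt1.
  exists q; first exact: pgroupP betaB q q_pr (dvdn_trans qBs (cardSg sBsB)).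
  exact: pgroupP t'Bs q q_pr qBs.
- exists b0; first exact: (subsetP sBG).
  move=> p rap; rewrite (compl_class_size defG abB coKB Bb0) (regK b0 Bb0 nZb0) indexg1.
  case/predU1P: rap => [-> | ap].
    have := pi_pHall hallR piGr (eqxx r); rewrite mem_primes => /and3P[_ _ pR].
    exact: dvdn_trans pR (cardSg sRK).
  have := pi_pHall hallA (piGa p ap) ap; rewrite mem_primes => /and3P[_ _ pA].
  exact: dvdn_trans pA (cardSg sAK).
- split.
    have ntRBs : [~: R, Bs] != 1.
      apply: contra ntBs => /eqP/commG1P cRBs; rewrite -subG1 -regBR subsetI sBsB centsC.
      exact: cRBs.
    have [u RBu ntu] := trivgPn _ ntRBs.
    have Ku : u \in K by rewrite (subsetP sRK) ?(subsetP sRBR).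
    exists (u * 1); first exact: GM.
    move=> p bp; rewrite classM //; last exact: commute1.
    rewrite regB ?inE ?ntu // indexg1 dvdn_mull //.
    by have := pi_pHall hallB (piGb p bp) bp; rewrite mem_primes => /and3P[].
  have [y Zy nty] := trivgPn _ ntZ; have [a Aa nta] := trivgPn _ ntA.
  have By := subsetP sZB y Zy; have Ka := subsetP sAK a Aa.
  have cay : commute a y by apply/commute_sym/(centP (subsetP cZA y Zy)).
  exists (a * y); first exact: GM.
  rewrite classM //; apply/andP; split.
    apply: dvdn_mulr; apply: contraR nty => r'y; rewrite -p'natE // in r'y.
    move: r'y; rewrite (pHall_sub_index nsRK hallRK) ?subsetIl // subsetI sub_cent1.
    by case/andP=> _ cRy; apply/eqP/set1gP; rewrite -regBR inE By.
  have sCZ : 'C_B[a] \subset 'Z(H).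
    by apply/subsetP=> b /setIP[Bb /cent1P cba]; apply: (regA a); rewrite ?inE ?nta.
  apply/dvdn_mull/t_dvd.
    apply: indexgS; rewrite subsetI sBsB sub_cent1; apply/centP=> b Bsb.
    by apply/commute_sym/(centP (subsetP cZA b (subsetP sBsZ b Bsb))).
  by rewrite indexg_eq1; apply/negP=> /subsetP/(_ b0 Bb0)/(subsetP sCZ); apply/negP.
- move=> x p q Gx ap bq px qx; have [u [y [Ku By cuy defn]]] := classE x Gx.
  have p_pr := primeG p (piGa p ap); have q_pr := primeG q (piGb q bq).
  have b'p : p \notin beta by have := disjAB p; rewrite ap.
  rewrite defn Euclid_dvdM // (negPf (beta'_index p _ p_pr b'p)) orbF in px.
  rewrite defn Euclid_dvdM // (negPf (beta_index q _ bq)) /= in qx.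
  have nZy : y \notin 'Z(H).
    apply: contraL px => Zy; rewrite -p'natE // .
    have := pHall_sub_index nsAK hallAK (subsetIl K 'C[y]).
    rewrite subsetI sAK sub_cent1 (subsetP cZA y Zy) => a'K.
    by apply: sub_in_pnat a'K => z _; apply: contraNneq => ->.
  have u1 : u = 1 by apply/set1gP; rewrite -(regK y By nZy) inE Ku; apply/cent1P.
  by move: qx; rewrite u1 cent11T setIT indexgg Euclid_dvd1.
move=> x q Gx bq nqt rx qx; have [u [y [Ku By cuy defn]]] := classE x Gx.
have q_pr := primeG q (piGb q bq).
rewrite defn Euclid_dvdM // (negPf (beta'_index r _ r_pr r'beta)) orbF in rx.
rewrite defn Euclid_dvdM // (negPf (beta_index q _ bq)) /= in qx.
have nty : y != 1.
  by apply: contraL rx => /eqP->; rewrite cent11T setIT indexgg Euclid_dvd1.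
have [a [z [Aa Rz defu cua cuz]]] := decomp u Ku.
have /subsetPn[b Bsb nCb] : ~~ (Bs \subset 'C_B[u]).
  apply: contraL qx => sBsC; apply/negP=> qB.
  have [_ _] := and3P hallBs; rewrite pnatNK => tB.
  have := pnat_dvd (indexgS B sBsC) tB; move/pnatP => /(_ (indexg_gt0 _ _) q q_pr qB).
  by rewrite inE /= (negPf nqt).
have Bb := subsetP sBsB b Bsb.
have cab : commute b a by apply: (centP (subsetP cZA b (subsetP sBsZ b Bsb))).
(* y commutes with z and b, so with this element of [~: R, Bs]: this contradicts
   the fixed-point freeness of B. *)
have ncbz : [~ z, b] != 1.
  apply: contra nCb => /commgP czb; rewrite inE Bb; apply/cent1P.
  by rewrite defu; apply: commuteM => //; apply: commute_sym.
have By1 : y \in B^# by rewrite !inE nty.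
case/eqP: ncbz; apply/set1gP; rewrite -(regBs y By1) inE mem_commg //.
have cyz : commute y z by apply/commute_sym/cuz.
have cyb : commute y b by apply: (centsP abB).
by apply/cent1P/commute_sym; rewrite /commg /conjg; do ?[apply: commuteM | apply: commuteV].
Qed.
End StructureClassSizes.

(** * The graph of a group with the structure *)

Section StructureGraph.
Variables (gT : finGroupType) (G : {group gT}) (r t : nat) (alpha beta : nat_pred).
Hypotheses (redG : reduced_group G) (r_pr : prime r) (t_pr : prime t) (nrt : r <> t).
Hypothesis struct : two_cut_vertex_structure G r t alpha beta.

Local Notation vertex := 'I_#|G|.+1.
Local Notation V := (cs_vertices G).
Local Notation e := (@cs_adj _ G).

Lemma structure_adj :
  [/\ t \in beta /\ (exists2 q, q \in beta & q != t),
      forall v w : vertex, val v \in [predU1 r & alpha] -> val w \in [predU1 r & alpha] -> v != w -> e v w,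
      (forall v w : vertex, val v \in beta -> val w \in beta -> v != w -> e v w) /\
      (forall v w : vertex, val v = r -> val w = t -> e v w),
      forall v w : vertex, val v \in alpha -> val w \in beta -> ~~ e v w
    & forall v w : vertex, val v = r -> val w \in beta -> val w != t -> ~~ e v w].
Proof.
have [part [A [B [R [H [Bs [condA condB]]]]]]] := struct.
have [beta_t [x Gx clA] [[y Gy clB] [z Gz clrt]] nAB nrB] :=
  structure_class_sizes r_pr t_pr part condA condB.
have [_ _ _ _ piG] := part.
have primeG q : q \in \pi(G) -> prime q by rewrite mem_primes => /and3P[].
have pr_rA q : q \in [predU1 r & alpha] -> prime q.
  by case/predU1P=> [-> // | aq]; apply: primeG; rewrite piG aq orbT.
have pr_B q : q \in beta -> prime q by move=> bq; apply: primeG; rewrite piG bq !orbT.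
have neqP (v w : vertex) : e v w -> v != w by case/and4P.
split=> //.
- move=> v w Av Aw nvw; apply/cs_adjP; rewrite ?pr_rA //.
  by exists x; rewrite ?(clA _ Av) ?(clA _ Aw).
- split=> v w Bv Bw => [nvw|].
    by apply/cs_adjP; rewrite ?pr_B //; exists y; rewrite ?(clB _ Bv) ?(clB _ Bw).
  have nvw : v != w by apply/eqP=> vw; apply: nrt; rewrite -Bv -Bw vw.
  have [pv pw] : prime (val v) /\ prime (val w) by rewrite Bv Bw.
  by apply/(cs_adjP pv pw nvw); exists z; rewrite // -?[nat_of_ord _]/(val _) Bv Bw.
- move=> v w Av Bw; have pv : prime (val v) by apply: pr_rA; apply/predU1P; right.
  have pw := pr_B _ Bw; apply/negP=> /[dup] /neqP nvw /(cs_adjP pv pw nvw)[u Gu /andP[vu wu]].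
  exact: (nAB u (val v) (val w)).
move=> v w Ev Bw nwt; have pv : prime (val v) by rewrite Ev.
have pw := pr_B _ Bw; apply/negP=> /[dup] /neqP nvw /(cs_adjP pv pw nvw)[u Gu /andP[vu wu]].
by apply: (nrB u (val w)); rewrite -?Ev.
Qed.

Lemma structure_components_minus :
  [/\ cs_components_minus G r = [set primes_in G alpha; primes_in G beta],
      primes_in G alpha != primes_in G beta,
      complete_on e (primes_in G alpha) & complete_on e (primes_in G beta)].
Proof.
have [[beta_t _] adjA [adjB _] nadjAB _] := structure_adj.
have [[[a alpha_a] _ dis /andP[nra nrb] piG] _] := struct.
have VE (v : vertex) : (v \in V) = [|| val v == r, val v \in alpha | val v \in beta].
  by rewrite (cs_verticesE redG) piG.
pose S := [set p in V | val p != r].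
have SE (v : vertex) : (v \in S) = (v \in primes_in G alpha) || (v \in primes_in G beta).
  rewrite [LHS]in_set VE [X in _ = X || _]in_set [X in _ = _ || X]in_set.
  have [-> | _] := eqVneq (val v) r; last by rewrite andbT.
  by rewrite (negPf nra) (negPf nrb).
have comA : complete_on e (primes_in G alpha).
  by move=> v w; rewrite !inE => Av Aw; apply: adjA; apply/predU1P; right.
have comB : complete_on e (primes_in G beta).
  by move=> v w; rewrite !inE => Bv Bw; apply: adjB.
have conn (C D : {set vertex}) x : complete_on e C -> (forall v, (v \in S) = (v \in C) || (v \in D)) ->
    {in C & D, forall v w, ~~ e v w} -> x \in C ->
  [set y in S | connect (induced_rel e S) x y] = C.
  move=> comC defS nadj Cx; apply/setP=> y; rewrite in_set.
  apply/andP/idP => [[_ cxy] | Cy].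
    apply: connect_closed_mem (Cx) cxy => v w Cv /and3P[_]; rewrite defS.
    by case/orP=> // Dw vw; case/negP: (nadj v w Cv Dw).
  split; first by rewrite defS Cy.
  have [-> | nxy] := eqVneq x y; first exact: connect0.
  by apply: connect1; rewrite /induced_rel /= !defS Cx Cy comC.
have nadjA : {in primes_in G alpha & primes_in G beta, forall v w, ~~ e v w}.
  by move=> v w; rewrite !inE; apply: nadjAB.
have nadjB : {in primes_in G beta & primes_in G alpha, forall v w, ~~ e v w}.
  by move=> v w Bv Aw; rewrite cs_adj_sym; apply: nadjA.
have SE' v : (v \in S) = (v \in primes_in G beta) || (v \in primes_in G alpha) by rewrite orbC SE.
have [va def_va] : exists v : vertex, val v = a.
  by apply: pi_vertex; rewrite piG alpha_a orbT.
have [vt def_vt] : exists v : vertex, val v = t.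
  by apply: pi_vertex; rewrite piG beta_t !orbT.
have Aa : va \in primes_in G alpha by rewrite inE def_va.
have Bt : vt \in primes_in G beta by rewrite inE def_vt.
have nAB : primes_in G alpha != primes_in G beta.
  apply: contraTneq Aa => ->; rewrite inE def_va.
  by apply: contra (dis a) => ->; rewrite alpha_a.
split=> //; apply/setP=> C; rewrite /cs_components_minus -/S.
apply/imsetP/set2P => [[x Sx ->] | [-> | ->]].
- move: (Sx); rewrite SE => /orP[Ax | Bx]; [left | right].
    exact: conn comA SE nadjA Ax.
  exact: conn comB SE' nadjB Bx.
- by exists va; rewrite ?SE ?Aa // (conn _ _ va comA SE nadjA).
by exists vt; rewrite ?SE' ?Bt // (conn _ _ vt comB SE' nadjB).
Qed.

Lemma structure_cut_vertices : cs_cut_vertex G r /\ cs_cut_vertex G t.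
Proof.
have [[beta_t [q beta_q nqt]] adjA [adjB adjrt] nadjAB nadjrB] := structure_adj.
have [[[a alpha_a] _ dis /andP[nra nrb] piG] _] := struct.
have VE (v : vertex) : (v \in V) = [|| val v == r, val v \in alpha | val v \in beta].
  by rewrite (cs_verticesE redG) piG.
have [va def_va] : exists v : vertex, val v = a.
  by apply: pi_vertex; rewrite piG alpha_a orbT.
have [vt def_vt] : exists v : vertex, val v = t.
  by apply: pi_vertex; rewrite piG beta_t !orbT.
have [vr def_vr] : exists v : vertex, val v = r by apply: pi_vertex; rewrite piG eqxx.
have [vq def_vq] : exists v : vertex, val v = q.
  by apply: pi_vertex; rewrite piG beta_q !orbT.
have Va : va \in V by rewrite VE def_va alpha_a orbT.
have Vt : vt \in V by rewrite VE def_vt beta_t !orbT.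
have Vr : vr \in V by rewrite VE def_vr eqxx.
have Vq : vq \in V by rewrite VE def_vq beta_q !orbT.
have symV := induced_connect_sym (@cs_adj_sym _ G) V.
have edge v w : v \in V -> w \in V -> e v w -> connect (induced_rel e V) v w.
  by move=> Vv Vw vw; apply: connect1; rewrite /induced_rel /= Vv Vw.
have neq_val (v w : vertex) : val v != val w -> v != w by apply: contra => /eqP->.
have connr v : v \in V -> connect (induced_rel e V) vr v.
  move=> Vv; have [-> | nrv] := eqVneq vr v; first exact: connect0.
  move: (Vv); rewrite VE orbA => /orP[rav | bv].
    by apply: edge => //; apply: adjA => //; rewrite def_vr !inE eqxx.
  apply: connect_trans (edge vr vt Vr Vt (adjrt _ _ def_vr def_vt)) _.
  have [-> | ntv] := eqVneq vt v; first exact: connect0.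
  by apply: edge => //; apply: adjB; rewrite ?def_vt.
have connt v : v \in V -> connect (induced_rel e V) vt v.
  move=> Vv; apply: connect_trans (connr v Vv); rewrite symV; exact: connr.
have nab p : p \in alpha -> p \notin beta by move=> ap; have := dis p; rewrite ap.
split.
  exists vr => //; apply: (cut_vertex_separated (@cs_adj_sym _ G) (a := va) (b := vt)) => //.
  - by rewrite in_setD1 Va andbT; apply: neq_val; rewrite def_va def_vr; apply: contraNneq nra => <-.
  - by rewrite in_setD1 Vt andbT; apply: neq_val; rewrite def_vt def_vr; apply/eqP=> /esym.
  apply: contraL beta_t => cat; apply: nab; rewrite -def_vt.
  pose P (v : vertex) := val v \in alpha; suffices: P vt by [].
  apply: connect_closed_mem cat => [v w Av /and3P[_ /setD1P[nwr Vw] vw] | ]; last by rewrite /P def_va.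
  move: Vw; rewrite VE -def_vr (inj_eq val_inj) (negPf nwr) /= => /orP[// | Bw].
  by case/negP: (nadjAB v w Av Bw).
exists vt => //; apply: (cut_vertex_separated (@cs_adj_sym _ G) (a := vr) (b := vq)) => //.
- by rewrite in_setD1 Vr andbT; apply: neq_val; rewrite def_vt def_vr; apply/eqP.
- by rewrite in_setD1 Vq andbT; apply: neq_val; rewrite def_vt def_vq.
apply/negP=> crq; pose P (v : vertex) := val v \in [predU1 r & alpha].
suffices : P vq.
  rewrite /P def_vq => /predU1P[qr | aq]; first by rewrite -qr beta_q in nrb.
  by have := nab q aq; rewrite beta_q.
apply: connect_closed_mem crq => [v w Pv /and3P[_ /setD1P[nwt Vw] vw] | ]; last by rewrite /P def_vr !inE eqxx.
move: Vw; rewrite VE orbA => /orP[// | Bw]; case/predU1P: Pv => [rv | Av].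
  have nwt' : val w != t by rewrite -def_vt (inj_eq val_inj).
  by case/negP: (nadjrB v w rv Bw nwt').
by case/negP: (nadjAB v w Av Bw).
Qed.

End StructureGraph.

Theorem theoremC (gT : finGroupType) (G : {group gT}) (r t : nat)
    (redG : reduced_group G) (r_pr : prime r) (t_pr : prime t) (neq_rt : r <> t) :
  (cs_cut_vertex G r /\ cs_cut_vertex G t <->
     exists alpha beta : nat_pred,
       two_cut_vertex_structure G r t alpha beta \/
       two_cut_vertex_structure G t r alpha beta) /\
  (forall alpha beta : nat_pred,
     two_cut_vertex_structure G r t alpha beta ->
     [/\ cs_components_minus G r = [set primes_in G alpha; primes_in G beta]%SET,
         primes_in G alpha != primes_in G beta,
         complete_on (@cs_adj gT G) (primes_in G alpha)
       & complete_on (@cs_adj gT G) (primes_in G beta)]).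
Proof.
split; last by move=> alpha beta; apply: structure_components_minus.
split=> [[cut_r cut_t] | [alpha [beta [struct | struct]]]].
- exact: cut_vertices_structure.
- exact: structure_cut_vertices struct.
have [cut_t cut_r] := structure_cut_vertices redG t_pr r_pr (nesym neq_rt) struct.
by split.
Qed.
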